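(* Let $M$ be a normal complex contact metric manifold of complex dimension $2n+1$ with local structure tensors $(G,H,J,U,V,u,v,g)$, and let $\rho$ be its Ricci tensor. Then for all horizontal vector fields $X,Y$ (i.e. sections of $\mathcal{H}$) $$\rho(GX,GY)=\rho(HX,HY)=\rho(X,Y),$$ $$\rho(GX,Y)=-\rho(X,GY),\qquad \rho(HX,Y)=-\rho(X,HY).$$
   Context: A complex contact manifold is a complex manifold $M$ of complex dimension $2n+1$ with an open covering by coordinate neighborhoods $\mathcal{U}$, each carrying a holomorphic 1-form $\theta$ with $\theta\wedge(d\theta)^n\neq 0$, such that on overlaps $\theta'=f\theta$ with $f$ holomorphic and non-vanishing. The horizontal distribution is $\mathcal{H}=\ker\theta$. A complex almost contact metric manifold is a Hermitian manifold $(M,J,g)$ with an open covering $\{\mathcal{U}\}$ such that: on each $\mathcal{U}$ there are real 1-forms $u$, $v=u\circ J$, with $g$-dual vector fields $U$, $V=-JU$ (so $u=g(U,\cdot)$, $v=g(V,\cdot)$, $u(U)=v(V)=1$, $u(V)=v(U)=0$), and $(1,1)$-tensors $G$, $H=GJ$ with $H^2=G^2=-I+u\otimes U+v\otimes V$, $GJ=-JG$, $GU=0$, $g(X,GY)=-g(GX,Y)$; and on overlaps $u'=au-bv$, $v'=bu+av$, $G'=aG-bH$, $H'=bG+aH$ for functions $a,b$ with $a^2+b^2=1$. The vertical distribution spanned by $U,V$ is assumed integrable. A complex contact metric manifold is a complex contact manifold with a complex almost contact metric structure such that locally $\theta$ is $u-iv$ up to a non-vanishing complex-valued function (so $\mathcal{H}=\ker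 u\cap\ker v$), and $du(X,Y)=g(X,GY)+\tfrac12(\sigma(X)v(Y)-\sigma(Y)v(X))$, $dv(X,Y)=g(X,HY)-\tfrac12(\sigma(X)u(Y)-\sigma(Y)u(X))$, where $\sigma(X)=g(\nabla_XU,V)$, $\nabla$ is the Levi-Civita connection of $g$, and the convention for 1-forms is $2\,d\omega(X,Y)=X\omega(Y)-Y\omega(X)-\omega([X,Y])$. For a $(1,1)$-tensor $A$ put $[A,A](X,Y)=(\nabla_{AX}A)Y-(\nabla_{AY}A)X-A(\nabla_XA)Y+A(\nabla_YA)X$. Define $S(X,Y)=[G,G](X,Y)+2g(X,GY)U-2g(X,HY)V+2(v(Y)HX-v(X)HY)+\sigma(GY)HX-\sigma(GX)HY+\sigma(X)GHY-\sigma(Y)GHX$, $T(X,Y)=[H,H](X,Y)-2g(X,GY)U+2g(X,HY)V+2(u(Y)GX-u(X)GY)+\sigma(HX)GY-\sigma(HY)GX+\sigma(X)GHY-\sigma(Y)GHX$. The manifold is normal if $S(X,Y)=T(X,Y)=0$ for all $X,Y\in\mathcal{H}$ and $S(X,U)=T(X,V)=0$ for all $X$. Identities involving $G,H,U,V,u,v$ are understood on each neighborhood $\mathcal{U}$. Curvature: $R(X,Y)Z=\nabla_X\nabla_YZ-\nabla_Y\nabla_XZ-\nabla_{[X,Y]}Z$. Ricci tensor: $\rho(X,Y)=\sum_a g(R(E_a,X)Y,E_a)$ for a local orthonormal frame $\{E_a\}$ of $TM$. *)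

(* Defs.v *)
From HB Require Import structures.
From mathcomp Require Import all_boot all_order all_algebra.
From mathcomp Require Import perm.
From mathcomp Require Import all_classical all_reals all_analysis.
From mathcomp Require Import complex.

Set Implicit Arguments.
Unset Strict Implicit.
Unset Printing Implicit Defensive.

Import Order.TTheory GRing.Theory Num.Theory.
Import numFieldNormedType.Exports.

Local Open Scope classical_set_scope.
Local Open Scope ring_scope.
Local Open Scope complex_scope.

Section Euclidean.
Context {R : realType}.

(* Meant for open [A]; in finite dimension these are the usual C^k classes. *)
Fixpoint Ck {V W : normedModType R} (k : nat) (A : set V) (f : V -> W) : Prop :=
  match k with
  | 0 => forall x, A x -> {for x, continuous f}
  | k'.+1 => (forall x, A x -> differentiable f x) /\
             (forall v, Ck k' A (fun x => 'D_v f x))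
  end.

Definition smooth {V W : normedModType R} (A : set V) (f : V -> W) : Prop :=
  forall k, Ck k A f.

(* C^N is 'cV[R]_(N + N), with z_k = x_k + i y_k stored as (x, y); [Jmx] is
   multiplication by i, sending (x, y) to (- y, x). *)
Definition Jmx {N : nat} : 'M[R]_(N + N) := block_mx 0 (- 1%:M) 1%:M 0.

Definition holomorphic_map {N : nat} (A : set 'cV[R]_(N + N))
    (f : 'cV[R]_(N + N) -> 'cV[R]_(N + N)) : Prop :=
  smooth A f /\
  forall x v, A x -> 'D_(Jmx *m v) f x = Jmx *m 'D_v f x.

Definition ev {m : nat} (a : 'rV[R]_m) (x : 'cV[R]_m) : R := (a *m x) 0 0.

Definition bil {m : nat} (B : 'M[R]_m) (x y : 'cV[R]_m) : R :=
  (x^T *m B *m y) 0 0.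

End Euclidean.

Record chart (R : realType) (N : nat) (M : topologicalType) := Chart {
  dom : set M;
  coord : M -> 'cV[R]_(N + N);
  param : 'cV[R]_(N + N) -> M }.

Section Charts.
Context {R : realType} {N : nat} {M : topologicalType}.
Implicit Types c : chart R N M.

Definition is_chart c : Prop :=
  [/\ open (dom c),
      open (coord c @` dom c),
      forall p, dom c p -> {for p, continuous (coord c)},
      forall x, (coord c @` dom c) x -> {for x, continuous (param c)} &
      forall p, dom c p -> param c (coord c p) = p].

Definition compatible c c' : Prop :=
  holomorphic_map (coord c @` (dom c `&` dom c')) (coord c' \o param c) /\
  holomorphic_map (coord c' @` (dom c `&` dom c')) (coord c \o param c').

End Charts.

Record complex_manifold (R : realType) (N : nat) (M : topologicalType) :=
  ComplexManifold {
  atlas : set (chart R N M);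
  chart_at : M -> chart R N M;
  atlas_chart : forall c, atlas c -> is_chart c;
  atlas_compatible : forall c c', atlas c -> atlas c' -> compatible c c';
  atlas_chart_at : forall p, atlas (chart_at p);
  dom_chart_at : forall p, dom (chart_at p) p;
  manifold_hausdorff : hausdorff_space M;
  manifold_second_countable : @second_countable M }.

Section Manifold.
Context {R : realType} {N : nat} {M : topologicalType}.
Variable (CM : complex_manifold R N M).

(* The real tangent space at p is represented in the distinguished chart
   [chart_at CM p]. As the transition maps have complex linear differentials,
   the complex structure J of M is the constant matrix [Jmx] in this
   representation. *)
Local Notation vec := 'cV[R]_(N + N).
Local Notation vfield := (M -> 'cV[R]_(N + N)).
Local Notation form := (M -> 'rV[R]_(N + N)).
Local Notation tensor := (M -> 'M[R]_(N + N)).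

Local Notation pt p := (coord (chart_at CM p) p).

Definition coordinate_nbhd (O : set M) : Prop :=
  exists c : chart R N M,
    [/\ is_chart c, dom c = O & forall c', atlas CM c' -> compatible c c'].

(* Components in the chart c of a tangent vector at p. *)
Definition tcoord (c : chart R N M) (p : M) (v : vec) : vec :=
  'D_v (coord c \o param (chart_at CM p)) (pt p).

(* Conversely, the tangent vector at p with given components in c. *)
Definition of_tcoord (c : chart R N M) (p : M) (w : vec) : vec :=
  'D_w (coord (chart_at CM p) \o param c) (coord c p).

Definition rep (c : chart R N M) (X : vfield) (x : vec) : vec :=
  tcoord c (param c x) (X (param c x)).

Definition smooth_fun {W : normedModType R} (O : set M) (f : M -> W) : Prop :=
  forall c, atlas CM c -> smooth (coord c @` (dom c `&` O)) (f \o param c).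

Definition smooth_vf (O : set M) (X : vfield) : Prop :=
  forall c, atlas CM c -> smooth (coord c @` (dom c `&` O)) (rep c X).

Definition tapply (A : tensor) (X : vfield) : vfield := fun p => A p *m X p.

Definition smooth_form (O : set M) (w : form) : Prop :=
  forall O' X, open O' -> O' `<=` O -> smooth_vf O' X ->
    smooth_fun O' (fun p => ev (w p) (X p) : R^o).

Definition smooth_endo (O : set M) (A : tensor) : Prop :=
  forall O' X, open O' -> O' `<=` O -> smooth_vf O' X -> smooth_vf O' (tapply A X).

Definition smooth_bil (O : set M) (B : tensor) : Prop :=
  forall O' X Y, open O' -> O' `<=` O -> smooth_vf O' X -> smooth_vf O' Y ->
    smooth_fun O' (fun p => bil (B p) (X p) (Y p) : R^o).

Definition ddir (f : M -> R) (p : M) (v : vec) : R :=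
  'D_v ((f : M -> R^o) \o param (chart_at CM p)) (pt p).

Definition bracket (X Y : vfield) : vfield := fun p =>
  let c := chart_at CM p in
  'D_(X p) (rep c Y) (pt p) - 'D_(Y p) (rep c X) (pt p).

(* Convention: 2 dw(X, Y) = X w(Y) - Y w(X) - w([X, Y]). *)
Definition ext_d (w : form) (X Y : vfield) (p : M) : R :=
  2^-1 * (ddir (fun q => ev (w q) (Y q)) p (X p)
          - ddir (fun q => ev (w q) (X q)) p (Y p)
          - ev (w p) (bracket X Y p)).

Local Notation cform := (M -> 'rV[R[i]]_(N + N)).

Definition evC (a : 'rV[R[i]]_(N + N)) (x : vec) : R[i] :=
  (a *m map_mx (real_complex R) x) 0 0.

Definition ext_dC (w : cform) (X Y : vfield) (p : M) : R[i] :=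
  ext_d (fun q => map_mx (@complex.Re R) (w q)) X Y p +i*
  ext_d (fun q => map_mx (@complex.Im R) (w q)) X Y p.

Definition ddirC (f : M -> R[i]) (p : M) (v : vec) : R[i] :=
  ddir (fun q => complex.Re (f q)) p v +i* ddir (fun q => complex.Im (f q)) p v.

Definition holomorphic_fun (O : set M) (f : M -> R[i]) : Prop :=
  [/\ smooth_fun O (fun p => complex.Re (f p) : R^o),
      smooth_fun O (fun p => complex.Im (f p) : R^o) &
      forall p v, O p -> ddirC f p (Jmx *m v) = (0 +i* 1) * ddirC f p v].

(* A (1,0)-form w = \sum_k f_k dz_k with holomorphic coefficients; here
   f_k = w(d/dx_k). *)
Definition holomorphic_form (O : set M) (w : cform) : Prop :=
  (forall p v, O p -> evC (w p) (Jmx *m v) = (0 +i* 1) * evC (w p) v) /\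
  (forall c (k : 'I_N), atlas CM c ->
     holomorphic_fun (dom c `&` O)
       (fun p => evC (w p) (of_tcoord c p (delta_mx (lshift N k) 0)))).

(* (w /\ (dw)^n)(X_0, ..., X_2n), where alpha /\ beta is the alternation of
   the tensor product of alpha and beta, in line with the factor of [ext_d]. *)
Definition wedge_dn (n : nat) (w : cform)
    (X : 'I_(n.*2.+1) -> vfield) (p : M) : R[i] :=
  (n.*2.+1`!%:R)^-1 *
  \sum_(s : 'S_(n.*2.+1))
    (-1) ^+ s * (evC (w p) (X (s ord0) p) *
      \prod_(i < n) ext_dC w (X (s (inord i.*2.+1))) (X (s (inord i.*2.+2))) p).

Record riemannian_metric (g : tensor) : Prop := {
  metric_smooth : smooth_bil setT g;
  metric_sym : forall p v w, bil (g p) v w = bil (g p) w v;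
  metric_pos : forall p v, v != 0 -> 0 < bil (g p) v v }.

Record hermitian_metric (g : tensor) : Prop := {
  hermitian_riemannian : riemannian_metric g;
  hermitian_J : forall p v w, bil (g p) (Jmx *m v) (Jmx *m w) = bil (g p) v w }.

(* [nabla] is meaningful on locally defined fields: its value at p only
   involves the arguments on a neighbourhood of p. *)
Record levi_civita (g : tensor) (nabla : vfield -> vfield -> vfield) : Prop := {
  nabla_local : forall O X X' Y Y', open O ->
    smooth_vf O X -> smooth_vf O X' -> smooth_vf O Y -> smooth_vf O Y' ->
    {in O, X =1 X'} -> {in O, Y =1 Y'} -> {in O, nabla X Y =1 nabla X' Y'};
  nabla_smooth : forall O X Y, open O -> smooth_vf O X -> smooth_vf O Y ->
    smooth_vf O (nabla X Y);
  nabla_addl : forall O X X' Y p, open O -> O p ->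
    smooth_vf O X -> smooth_vf O X' -> smooth_vf O Y ->
    nabla (fun q => X q + X' q) Y p = nabla X Y p + nabla X' Y p;
  nabla_scalel : forall O (f : M -> R) X Y p, open O -> O p ->
    smooth_fun O (f : M -> R^o) -> smooth_vf O X -> smooth_vf O Y ->
    nabla (fun q => f q *: X q) Y p = f p *: nabla X Y p;
  nabla_addr : forall O X Y Y' p, open O -> O p ->
    smooth_vf O X -> smooth_vf O Y -> smooth_vf O Y' ->
    nabla X (fun q => Y q + Y' q) p = nabla X Y p + nabla X Y' p;
  nabla_leibniz : forall O (f : M -> R) X Y p, open O -> O p ->
    smooth_fun O (f : M -> R^o) -> smooth_vf O X -> smooth_vf O Y ->
    nabla X (fun q => f q *: Y q) p = ddir f p (X p) *: Y p + f p *: nabla X Y p;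
  nabla_torsion_free : forall O X Y p, open O -> O p ->
    smooth_vf O X -> smooth_vf O Y ->
    nabla X Y p - nabla Y X p = bracket X Y p;
  nabla_metric : forall O X Y Z p, open O -> O p ->
    smooth_vf O X -> smooth_vf O Y -> smooth_vf O Z ->
    ddir (fun q => bil (g q) (Y q) (Z q)) p (X p) =
    bil (g p) (nabla X Y p) (Z p) + bil (g p) (Y p) (nabla X Z p) }.

Section Connection.
Variables (g : tensor) (nabla : vfield -> vfield -> vfield).

Definition cov_endo (A : tensor) (X Y : vfield) : vfield := fun p =>
  nabla X (tapply A Y) p - A p *m nabla X Y p.

(* [A, A] *)
Definition torsion_endo (A : tensor) (X Y : vfield) : vfield := fun p =>
  cov_endo A (tapply A X) Y p - cov_endo A (tapply A Y) X p
  - A p *m cov_endo A X Y p + A p *m cov_endo A Y X p.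

Definition curvature (X Y Z : vfield) : vfield := fun p =>
  nabla X (nabla Y Z) p - nabla Y (nabla X Z) p - nabla (bracket X Y) Z p.

Definition orthonormal_frame (O : set M) (E : 'I_(N + N) -> vfield) : Prop :=
  (forall a, smooth_vf O (E a)) /\
  (forall p a b, O p -> bil (g p) (E a p) (E b p) = (a == b)%:R).

Definition is_ricci (rho : tensor) : Prop :=
  forall O (E : 'I_(N + N) -> vfield) X Y, open O -> orthonormal_frame O E ->
    smooth_vf O X -> smooth_vf O Y ->
    forall p, O p ->
      bil (rho p) (X p) (Y p) =
      \sum_(a < N + N) bil (g p) (curvature (E a) X Y p) (E a p).

End Connection.

(* The tensors u, v, U, V, G, H; only their values on the relevant
   neighbourhood matter. *)
Record structure_tensors := StructureTensors {
  su : form; sv : form;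
  sU : vfield; sV : vfield;
  sG : tensor; sH : tensor }.

Record local_almost_contact_metric (g : tensor) (O : set M)
    (L : structure_tensors) : Prop := {
  lac_smooth_u : smooth_form O (su L);
  lac_smooth_v : smooth_form O (sv L);
  lac_smooth_U : smooth_vf O (sU L);
  lac_smooth_V : smooth_vf O (sV L);
  lac_smooth_G : smooth_endo O (sG L);
  lac_smooth_H : smooth_endo O (sH L);
  lac_vE : forall p, O p -> sv L p = su L p *m Jmx;
  lac_VE : forall p, O p -> sV L p = - (Jmx *m sU L p);
  lac_u_dual : forall p x, O p -> ev (su L p) x = bil (g p) (sU L p) x;
  lac_v_dual : forall p x, O p -> ev (sv L p) x = bil (g p) (sV L p) x;
  lac_uU : forall p, O p -> ev (su L p) (sU L p) = 1;
  lac_vV : forall p, O p -> ev (sv L p) (sV L p) = 1;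
  lac_uV : forall p, O p -> ev (su L p) (sV L p) = 0;
  lac_vU : forall p, O p -> ev (sv L p) (sU L p) = 0;
  lac_HE : forall p, O p -> sH L p = sG L p *m Jmx;
  lac_GG : forall p, O p -> sG L p *m sG L p =
    - 1%:M + sU L p *m su L p + sV L p *m sv L p;
  lac_HH : forall p, O p -> sH L p *m sH L p =
    - 1%:M + sU L p *m su L p + sV L p *m sv L p;
  lac_GJ : forall p, O p -> sG L p *m Jmx = - (Jmx *m sG L p);
  lac_GU : forall p, O p -> sG L p *m sU L p = 0;
  lac_G_skew : forall p x y, O p ->
    bil (g p) x (sG L p *m y) = - bil (g p) (sG L p *m x) y }.

Definition vertical (L : structure_tensors) (O : set M) (X : vfield) : Prop :=
  forall p, O p -> exists a b : R, X p = a *: sU L p + b *: sV L p.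

Record almost_contact_structure := AlmostContactStructure {
  ac_index : Type;
  ac_nbhd : ac_index -> set M;
  ac_tensors : ac_index -> structure_tensors }.

(* Integrability of the vertical distribution is stated as closure of its local
   sections under the bracket. *)
Record complex_almost_contact_metric (g : tensor)
    (S : almost_contact_structure) : Prop := {
  cac_hermitian : hermitian_metric g;
  cac_open : forall i : ac_index S, open (ac_nbhd i);
  cac_cover : forall p, exists i : ac_index S, ac_nbhd i p;
  cac_local : forall i : ac_index S,
    local_almost_contact_metric g (ac_nbhd i) (ac_tensors i);
  cac_overlap : forall i j : ac_index S, exists a b : M -> R,
    forall p, (ac_nbhd i `&` ac_nbhd j) p ->
      let L := ac_tensors i in let L' := ac_tensors j in
      [/\ a p ^+ 2 + b p ^+ 2 = 1,
          su L' p = a p *: su L p - b p *: sv L p,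
          sv L' p = b p *: su L p + a p *: sv L p,
          sG L' p = a p *: sG L p - b p *: sH L p &
          sH L' p = b p *: sG L p + a p *: sH L p];
  cac_integrable : forall (i : ac_index S) O X Y,
    open O -> O `<=` ac_nbhd i -> smooth_vf O X -> smooth_vf O Y ->
    vertical (ac_tensors i) O X -> vertical (ac_tensors i) O Y ->
    vertical (ac_tensors i) O (bracket X Y) }.

Record contact_structure := ContactStructure {
  ct_index : Type;
  ct_nbhd : ct_index -> set M;
  ct_form : ct_index -> cform }.

Definition horizontal (K : contact_structure) (O : set M) (X : vfield) : Prop :=
  forall (j : ct_index K) p, O p -> ct_nbhd j p -> evC (ct_form j p) (X p) = 0.

End Manifold.

Section Contact.
Context {R : realType} {n : nat} {M : topologicalType}.
Local Notation N := (n.*2.+1).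
Variable (CM : complex_manifold R N M).
Local Notation vfield := (M -> 'cV[R]_(N + N)).
Local Notation tensor := (M -> 'M[R]_(N + N)).

(* theta /\ (dtheta)^n <> 0 at p is witnessed by smooth fields near p. *)
Record complex_contact (K : @contact_structure R N M) : Prop := {
  cc_coordinate : forall j : ct_index K, coordinate_nbhd CM (ct_nbhd j);
  cc_cover : forall p, exists j : ct_index K, ct_nbhd j p;
  cc_holomorphic : forall j : ct_index K,
    holomorphic_form CM (ct_nbhd j) (ct_form j);
  cc_nondegenerate : forall (j : ct_index K) p, ct_nbhd j p ->
    exists (O : set M) (X : 'I_N -> vfield),
      [/\ open O, O p, forall k, smooth_vf CM O (X k) &
          wedge_dn CM (ct_form j) X p != 0];
  cc_overlap : forall j k : ct_index K, exists f : M -> R[i],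
    holomorphic_fun CM (ct_nbhd j `&` ct_nbhd k) f /\
    forall p, (ct_nbhd j `&` ct_nbhd k) p ->
      f p != 0 /\ ct_form k p = f p *: ct_form j p }.

Section Metric.
Variables (g : tensor) (nabla : vfield -> vfield -> vfield).

Definition sigma (L : @structure_tensors R N M) (X : vfield) (p : M) : R :=
  bil (g p) (nabla X (sU L) p) (sV L p).

Record complex_contact_metric (K : @contact_structure R N M)
    (S : @almost_contact_structure R N M) : Prop := {
  ccm_contact : complex_contact K;
  ccm_almost_contact : complex_almost_contact_metric CM g S;
  ccm_theta : forall (i : ac_index S) (j : ct_index K), exists f : M -> R[i],
    forall p, (ac_nbhd i `&` ct_nbhd j) p ->
      f p != 0 /\
      ct_form j p = f p *: (map_mx (real_complex R) (su (ac_tensors i) p)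
                            - (0 +i* 1) *: map_mx (real_complex R) (sv (ac_tensors i) p));
  ccm_du : forall (i : ac_index S) O X Y p, open O -> O `<=` ac_nbhd i -> O p ->
    smooth_vf CM O X -> smooth_vf CM O Y ->
    let L := ac_tensors i in
    ext_d CM (su L) X Y p =
      bil (g p) (X p) (sG L p *m Y p)
      + 2^-1 * (sigma L X p * ev (sv L p) (Y p)
                - sigma L Y p * ev (sv L p) (X p));
  ccm_dv : forall (i : ac_index S) O X Y p, open O -> O `<=` ac_nbhd i -> O p ->
    smooth_vf CM O X -> smooth_vf CM O Y ->
    let L := ac_tensors i in
    ext_d CM (sv L) X Y p =
      bil (g p) (X p) (sH L p *m Y p)
      - 2^-1 * (sigma L X p * ev (su L p) (Y p)
                - sigma L Y p * ev (su L p) (X p)) }.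

Definition tensorS (L : @structure_tensors R N M) (X Y : vfield) : vfield :=
  fun p =>
  let: (v, G, H) := (sv L p, sG L p, sH L p) in
  torsion_endo nabla (sG L) X Y p
  + (2 * bil (g p) (X p) (G *m Y p)) *: sU L p
  - (2 * bil (g p) (X p) (H *m Y p)) *: sV L p
  + 2 *: (ev v (Y p) *: (H *m X p) - ev v (X p) *: (H *m Y p))
  + sigma L (tapply (sG L) Y) p *: (H *m X p)
  - sigma L (tapply (sG L) X) p *: (H *m Y p)
  + sigma L X p *: (G *m (H *m Y p))
  - sigma L Y p *: (G *m (H *m X p)).

Definition tensorT (L : @structure_tensors R N M) (X Y : vfield) : vfield :=
  fun p =>
  let: (u, G, H) := (su L p, sG L p, sH L p) in
  torsion_endo nabla (sH L) X Y p
  - (2 * bil (g p) (X p) (G *m Y p)) *: sU L p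
  + (2 * bil (g p) (X p) (H *m Y p)) *: sV L p
  + 2 *: (ev u (Y p) *: (G *m X p) - ev u (X p) *: (G *m Y p))
  + sigma L (tapply (sH L) X) p *: (G *m Y p)
  - sigma L (tapply (sH L) Y) p *: (G *m X p)
  + sigma L X p *: (G *m (H *m Y p))
  - sigma L Y p *: (G *m (H *m X p)).

Record normal_structure (K : @contact_structure R N M)
    (S : @almost_contact_structure R N M) : Prop := {
  normal_horizontal : forall (i : ac_index S) O X Y p,
    open O -> O `<=` ac_nbhd i -> O p ->
    smooth_vf CM O X -> smooth_vf CM O Y ->
    horizontal K O X -> horizontal K O Y ->
    tensorS (ac_tensors i) X Y p = 0 /\ tensorT (ac_tensors i) X Y p = 0;
  normal_vertical : forall (i : ac_index S) O X p,
    open O -> O `<=` ac_nbhd i -> O p -> smooth_vf CM O X ->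
    tensorS (ac_tensors i) X (sU (ac_tensors i)) p = 0 /\
    tensorT (ac_tensors i) X (sV (ac_tensors i)) p = 0 }.

End Metric.
End Contact.

(* Main.v *)
Require Import Defs.
From HB Require Import structures.
From mathcomp Require Import all_boot all_order all_algebra.
From mathcomp Require Import all_classical all_reals all_analysis.
From mathcomp Require Import complex ring.
(* Imported last, so that [coord] is the coordinate map of a chart. *)
Import Defs.

Set Implicit Arguments.
Unset Strict Implicit.
Unset Printing Implicit Defensive.

Import Order.TTheory GRing.Theory Num.Theory.
Import numFieldNormedType.Exports.

Local Open Scope classical_set_scope.
Local Open Scope ring_scope.

(** The proof has an algebraic and an analytic half.

    Write u, v for the dual forms of the vertical fields U, V. The structure
    equation for du says that nabla_X U is sigma(X) V - GX up to a symmetric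
    error. Normality in the direction U computes the derivative of G along U
    from that error, and the closedness of du computes it differently; so the
    error vanishes ([shape_eq0]) and nabla_X U = sigma(X) V - GX. Normality on
    horizontal vectors, combined with the closedness of du and with G^2 = -1,
    gives (nabla_X G) Y = sigma(X) HY up to vertical terms ([covG_hor]). The
    only part of nabla G that stays undetermined is the endomorphism
    P = nabla_V G - sigma(V) H; it is skew, anticommutes with G, and the Bianchi
    identity expresses d sigma on horizontal vectors by P and the metric
    ([dsigma_hor]).

    The Ricci identity for G ([curv_comm_G]) therefore compares
    g(R(X,Y)GZ,GW) with g(R(X,Y)Z,W) by terms built from g, G, H and P only.
    Applying it to both pairs of arguments of the curvature, the terms without P
    cancel, and g(R(GX,GY)GZ,GW) differs from g(R(X,Y)Z,W) by
      2 [ g(PX,Y) g(GHZ,W) - g(PZ,W) g(GHX,Y)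
          - g(HX,Y) g(GPZ,W) + g(HZ,W) g(GPX,Y) ]
    ([curv_GGGG]). In the trace over X = W these products cancel in pairs. The
    vertical directions contribute twice the metric, since
    g(R(U,Y)Z,U) = g(R(V,Y)Z,V) = g(Y,Z) for horizontal Y, Z. Hence
    rho(GY,GZ) = rho(Y,Z) ([ricci_GG]). Rotating (U, V, G, H) to (V, -U, H, -G)
    preserves all hypotheses and exchanges S with T ([contact_pair_rot]), which
    gives the statement for H; the skew identities follow on replacing Y by GY or
    HY.

    These computations are algebra over the ring of smooth functions on an open
    set, acting on the module of vector fields. The analytic half shows that the
    smooth fields on a small open set form such a structure: products and
    composites of C^k maps are C^k, mixed derivatives commute
    ([derive_symmetric]), hence brackets act as commutators ([ddir_bracket]), and
    a smooth orthonormal frame exists near every point ([frame_exists]). *)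

(** * Algebra of a metric connection *)

(** The calculus of a Levi-Civita connection as pure algebra: [A] stands for the
    smooth functions on an open set and [V] for its module of vector fields, so
    that tensoriality is [A]-linearity and smoothness is carried by the types.
    The bracket is the torsion-free one, and [lca_lie] says that it acts on
    functions as the commutator. [lca_faithful] makes the Jacobi identity a
    consequence.

    The defined operations of this part are [locked]: their bodies are sums, and
    the linearity rewrite rules would otherwise match through them. *)
Record levi_civita_algebra (A : comPzRingType) (V : lmodType A)
    (g : V -> V -> A) (D : V -> A -> A) (nab : V -> V -> V) : Prop := {
  lca_reg2 : forall a : A, a *+ 2 = 0 -> a = 0;
  lca_sym : forall X Y, g X Y = g Y X;
  lca_gD : forall X Y Z, g (X + Y) Z = g X Z + g Y Z;
  lca_gZ : forall a X Y, g (a *: X) Y = a * g X Y;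
  lca_nondeg : forall X, (forall Z, g X Z = 0) -> X = 0;
  lca_DD : forall X a b, D X (a + b) = D X a + D X b;
  lca_DM : forall X a b, D X (a * b) = D X a * b + a * D X b;
  lca_faithful : forall X, (forall a, D X a = 0) -> X = 0;
  lca_DDl : forall X Y a, D (X + Y) a = D X a + D Y a;
  lca_DZl : forall a X b, D (a *: X) b = a * D X b;
  lca_Dl : forall X X' Y, nab (X + X') Y = nab X Y + nab X' Y;
  lca_Zl : forall a X Y, nab (a *: X) Y = a *: nab X Y;
  lca_Dr : forall X Y Y', nab X (Y + Y') = nab X Y + nab X Y';
  lca_Zr : forall a X Y, nab X (a *: Y) = D X a *: Y + a *: nab X Y;
  lca_metric : forall X Y Z, D X (g Y Z) = g (nab X Y) Z + g Y (nab X Z);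
  lca_lie : forall X Y a,
    D (nab X Y - nab Y X) a = D X (D Y a) - D Y (D X a) }.

Section Curvature.
Context {A : comPzRingType} {V : lmodType A}.
Variable nab : V -> V -> V.

Definition lie (X Y : V) : V := locked (nab X Y - nab Y X).

Definition curv (X Y Z : V) : V :=
  locked (nab X (nab Y Z) - nab Y (nab X Z) - nab (lie X Y) Z).

Definition cov (T : V -> V) (X Y : V) : V :=
  locked (nab X (T Y) - T (nab X Y)).

Lemma lieE X Y : lie X Y = nab X Y - nab Y X.
Proof. by rewrite /lie -lock. Qed.

Lemma curvE X Y Z :
  curv X Y Z = nab X (nab Y Z) - nab Y (nab X Z) - nab (lie X Y) Z.
Proof. by rewrite /curv -lock. Qed.

Lemma covE T X Y : cov T X Y = nab X (T Y) - T (nab X Y).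
Proof. by rewrite /cov -lock. Qed.

End Curvature.

Section LeviCivitaAlgebra.
Context {A : comPzRingType} {V : lmodType A}.
Context {g : V -> V -> A} {D : V -> A -> A} {nab : V -> V -> V}.
Hypothesis L : levi_civita_algebra g D nab.
Implicit Types (a b : A) (X Y Z W : V).

Local Notation lie := (lie nab).
Local Notation curv := (curv nab).

Lemma two_regular a : a *+ 2 = 0 -> a = 0. Proof. exact: lca_reg2 L a. Qed.
Lemma gC X Y : g X Y = g Y X. Proof. exact: lca_sym L X Y. Qed.
Lemma gDl X Y Z : g (X + Y) Z = g X Z + g Y Z. Proof. exact: lca_gD L X Y Z. Qed.
Lemma gZl a X Y : g (a *: X) Y = a * g X Y. Proof. exact: lca_gZ L a X Y. Qed.
Lemma gDr X Y Z : g Z (X + Y) = g Z X + g Z Y.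
Proof. by rewrite !(gC Z) gDl. Qed.
Lemma gZr a X Y : g Y (a *: X) = a * g Y X.
Proof. by rewrite !(gC Y) gZl. Qed.
Lemma gNl X Y : g (- X) Y = - g X Y.
Proof. by rewrite -scaleN1r gZl mulN1r. Qed.
Lemma gNr X Y : g Y (- X) = - g Y X.
Proof. by rewrite !(gC Y) gNl. Qed.
Lemma g0l Y : g 0 Y = 0. Proof. by rewrite -(scale0r 0) gZl mul0r. Qed.
Lemma g0r Y : g Y 0 = 0. Proof. by rewrite gC g0l. Qed.
Lemma gMnl X Y n : g (X *+ n) Y = g X Y *+ n.
Proof. by elim: n => [|n IHn]; rewrite ?mulr0n ?g0l // !mulrS gDl IHn. Qed.
Definition gE := (gDl, gDr, gNl, gNr, gZl, gZr, g0l, g0r, gMnl).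

Lemma g_suml (I : finType) (F : I -> V) Y :
  g (\sum_i F i) Y = \sum_i g (F i) Y.
Proof.
exact: (big_morph (g^~ Y) (fun X X' => gDl X X' Y) (g0l Y)).
Qed.

Lemma g_eq X Y : (forall Z, g X Z = g Y Z) -> X = Y.
Proof.
move=> e; apply/subr0_eq/(lca_nondeg L) => Z.
by rewrite !gE e subrr.
Qed.

Lemma DDr X a b : D X (a + b) = D X a + D X b. Proof. exact: lca_DD L X a b. Qed.
Lemma DM X a b : D X (a * b) = D X a * b + a * D X b.
Proof. exact: lca_DM L X a b. Qed.
Lemma D1 X : D X 1 = 0.
Proof.
have := DM X 1 1; rewrite !mul1r mulr1 => e.
by apply: (addrI (D X 1)); rewrite addr0.
Qed.
Lemma D0 X : D X 0 = 0.
Proof. by apply: (addrI (D X 0)); rewrite -DDr !addr0. Qed.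
Lemma DN X a : D X (- a) = - D X a.
Proof. by apply/eqP; rewrite -addr_eq0 -DDr addNr D0. Qed.
Lemma DDl X Y a : D (X + Y) a = D X a + D Y a. Proof. exact: lca_DDl L X Y a. Qed.
Lemma DZl a X b : D (a *: X) b = a * D X b. Proof. exact: lca_DZl L a X b. Qed.
Lemma DNl X a : D (- X) a = - D X a. Proof. by rewrite -scaleN1r DZl mulN1r. Qed.
Definition DE := (DDr, DN, DM, D0, D1, DDl, DZl, DNl).

Lemma nDl X Y Z : nab (X + Y) Z = nab X Z + nab Y Z. Proof. exact: lca_Dl L X Y Z. Qed.
Lemma nZl a X Y : nab (a *: X) Y = a *: nab X Y. Proof. exact: lca_Zl L a X Y. Qed.
Lemma nDr X Y Z : nab X (Y + Z) = nab X Y + nab X Z. Proof. exact: lca_Dr L X Y Z. Qed.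
Lemma nZr a X Y : nab X (a *: Y) = D X a *: Y + a *: nab X Y.
Proof. exact: lca_Zr L a X Y. Qed.
Lemma nNl X Y : nab (- X) Y = - nab X Y. Proof. by rewrite -scaleN1r nZl scaleN1r. Qed.
Lemma nNr X Y : nab X (- Y) = - nab X Y.
Proof. by rewrite -scaleN1r nZr DN D1 oppr0 scale0r add0r scaleN1r. Qed.
Lemma n0r X : nab X 0 = 0. Proof. by apply: (addrI (nab X 0)); rewrite -nDr !addr0. Qed.
Lemma n0l X : nab 0 X = 0. Proof. by apply: (addrI (nab 0 X)); rewrite -nDl !addr0. Qed.
Definition nE := (nDl, nDr, nNl, nNr, nZl, nZr, n0l, n0r).
Lemma Dg X Y Z : D X (g Y Z) = g (nab X Y) Z + g Y (nab X Z).
Proof. exact: lca_metric L X Y Z. Qed.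
Lemma D_lie X Y a : D (lie X Y) a = D X (D Y a) - D Y (D X a).
Proof. by rewrite lieE; exact: lca_lie L X Y a. Qed.

(** Vector fields are determined by their derivations, and commutators of
    derivations satisfy the Jacobi identity. *)
Lemma jacobi X Y Z : lie X (lie Y Z) + lie Y (lie Z X) + lie Z (lie X Y) = 0.
Proof.
apply: (lca_faithful L) => a; rewrite !DDl !D_lie !DE; ring.
Qed.

Lemma curv12 X Y Z : curv Y X Z = - curv X Y Z.
Proof.
rewrite !curvE.
have -> : lie Y X = - lie X Y by rewrite !lieE opprB.
by rewrite nNl opprK !opprB addrC addrA.
Qed.

Lemma bianchi X Y Z : curv X Y Z + curv Y Z X + curv Z X Y = 0.
Proof.
rewrite -[RHS](jacobi X Y Z); apply: g_eq => W.
by rewrite !curvE !lieE !nE !gE; ring.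
Qed.

(** Apply [D_lie] to the function [g Z W] and expand by metric compatibility. *)
Lemma curv34 X Y Z W : g (curv X Y Z) W = - g (curv X Y W) Z.
Proof.
apply/eqP; rewrite -addr_eq0; apply/eqP.
have := D_lie X Y (g Z W); rewrite !Dg !DE !Dg => e.
rewrite !curvE !gE.
move/eqP: e; rewrite -subr_eq0 => /eqP e.
(* Both sides of the commutator identity, moved to one side. *)
transitivity (- (g (nab (lie X Y) Z) W + g Z (nab (lie X Y) W) -
    (g (nab X (nab Y Z)) W + g (nab Y Z) (nab X W) +
     (g (nab X Z) (nab Y W) + g Z (nab X (nab Y W))) -
     (g (nab Y (nab X Z)) W + g (nab X Z) (nab Y W) +
      (g (nab Y Z) (nab X W) + g Z (nab Y (nab X W))))))).
  by rewrite !(gC Z); ring.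
by rewrite e oppr0.
Qed.

Lemma bianchi_g X Y Z W :
  g (curv X Y Z) W + g (curv Y Z X) W + g (curv Z X Y) W = 0.
Proof. by rewrite -!gDl bianchi g0l. Qed.

(** The classical octahedron argument: four instances of the first Bianchi
    identity, combined with signs, leave twice the claim. *)
Lemma curv_pair X Y Z W : g (curv X Y Z) W = g (curv Z W X) Y.
Proof.
apply/subr0_eq/two_regular.
transitivity (
  (g (curv Z X Y) W + g (curv X Y Z) W + g (curv Y Z X) W)
 - (g (curv X Y W) Z + g (curv Y W X) Z + g (curv W X Y) Z)
 - (g (curv Y W Z) X + g (curv W Z Y) X + g (curv Z Y W) X)
 + (g (curv W Z X) Y + g (curv Z X W) Y + g (curv X W Z) Y)).
  rewrite (curv34 X Y W Z) (curv34 Z X W Y) (curv34 Y W X Z) (curv34 W Z Y X).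
  rewrite (curv34 Z Y W X) (curv12 Y Z) (curv34 W X Y Z) (curv12 X W) (curv12 Z W).
  by rewrite !gE; ring.
by rewrite !bianchi_g; ring.
Qed.

Lemma curvDl X X' Y Z : curv (X + X') Y Z = curv X Y Z + curv X' Y Z.
Proof. by apply: g_eq => W; rewrite !curvE !lieE !nE !gE; ring. Qed.

Lemma curvZl a X Y Z : curv (a *: X) Y Z = a *: curv X Y Z.
Proof. by apply: g_eq => W; rewrite !curvE !lieE !nE !gE; ring. Qed.

(** The form [w] is twice the exterior derivative of the form dual to [W]; this
    is [d (d W) = 0] written with the connection, and it is the first Bianchi
    identity paired with [W]. *)
Lemma exterior_derivative_exact X Y Z W :
  let w Y' Z' := g (nab Y' W) Z' - g (nab Z' W) Y' in
  let dw X' Y' Z' := D X' (w Y' Z') - w (nab X' Y') Z' - w Y' (nab X' Z') in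
  dw X Y Z + dw Y Z X + dw Z X Y = 0.
Proof.
move=> w dw.
transitivity (- (g (curv X Y Z) W + g (curv Y Z X) W + g (curv Z X Y) W));
  last by rewrite bianchi_g oppr0.
rewrite !(curv34 _ _ _ W) /dw /w !DE !Dg !curvE !lieE !nE !gE.
by ring.
Qed.

End LeviCivitaAlgebra.

(** * Normal contact pairs *)

Section ContactPairs.
Context {A : comPzRingType} {V : lmodType A}.
Variables (g : V -> V -> A) (nab : V -> V -> V).

(** The form sigma, with [xi], [eta] in the roles of U, V. *)
Definition connform (xi eta X : V) : A := locked (g (nab X xi) eta).
Lemma connformE xi eta X : connform xi eta X = g (nab X xi) eta.
Proof. by rewrite /connform -lock. Qed.
Definition is_horizontal (xi eta X : V) := g X xi = 0 /\ g X eta = 0.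

Definition nijenhuis (T : V -> V) (X Y : V) : V := locked
  (cov nab T (T X) Y - cov nab T (T Y) X - T (cov nab T X Y) + T (cov nab T Y X)).

Lemma nijenhuisE T X Y : nijenhuis T X Y =
  cov nab T (T X) Y - cov nab T (T Y) X - T (cov nab T X Y) + T (cov nab T Y X).
Proof. by rewrite /nijenhuis -lock. Qed.

(** The tensor S of the structure. The tensor T is the tensor S of the rotated
    structure [(eta, - xi, H, - G)]. *)
Definition normalS (xi eta : V) (G H : V -> V) (X Y : V) :=
  let s := connform xi eta in
  nijenhuis G X Y + (g X (G Y) *+ 2) *: xi - (g X (H Y) *+ 2) *: eta
  + (g eta Y *: H X - g eta X *: H Y) *+ 2
  + s (G Y) *: H X - s (G X) *: H Y + s X *: G (H Y) - s Y *: G (H X).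

(** The structure tensors in algebraic form: [xi], [eta] are U, V, and u, v are
    the forms [g xi], [g eta]. On horizontal vectors J is minus the composite of
    G and H. [cp_du] and [cp_dv] are the structure equations multiplied by 2,
    with the exterior derivative expressed by the connection. *)
Record contact_pair (xi eta : V) (G H : V -> V) : Prop := {
  cp_GD : forall X Y, G (X + Y) = G X + G Y;
  cp_GZ : forall a X, G (a *: X) = a *: G X;
  cp_HD : forall X Y, H (X + Y) = H X + H Y;
  cp_HZ : forall a X, H (a *: X) = a *: H X;
  cp_11 : g xi xi = 1;
  cp_22 : g eta eta = 1;
  cp_12 : g xi eta = 0;
  cp_G1 : G xi = 0;
  cp_G2 : G eta = 0;
  cp_H1 : H xi = 0;
  cp_H2 : H eta = 0;
  cp_GG : forall X, G (G X) = - X + g X xi *: xi + g X eta *: eta;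
  cp_HH : forall X, H (H X) = - X + g X xi *: xi + g X eta *: eta;
  cp_HG : forall X, H (G X) = - G (H X);
  cp_Gskew : forall X Y, g X (G Y) = - g (G X) Y;
  cp_Hskew : forall X Y, g X (H Y) = - g (H X) Y;
  cp_du : forall X Y, g (nab X xi) Y - g (nab Y xi) X =
    g X (G Y) *+ 2
    + (connform xi eta X * g Y eta - connform xi eta Y * g X eta);
  cp_dv : forall X Y, g (nab X eta) Y - g (nab Y eta) X =
    g X (H Y) *+ 2
    - (connform xi eta X * g Y xi - connform xi eta Y * g X xi);
  cp_S_hor : forall X Y, is_horizontal xi eta X -> is_horizontal xi eta Y ->
    normalS xi eta G H X Y = 0;
  cp_T_hor : forall X Y, is_horizontal xi eta X -> is_horizontal xi eta Y ->
    normalS eta (- xi) H (fun Z => - G Z) X Y = 0;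
  cp_S_vert : forall X, normalS xi eta G H X xi = 0;
  cp_T_vert : forall X, normalS eta (- xi) H (fun Z => - G Z) X eta = 0 }.

End ContactPairs.

Section NormalContactPair.
Context {A : comPzRingType} {V : lmodType A}.
Context {g : V -> V -> A} {D : V -> A -> A} {nab : V -> V -> V}.
Hypothesis L : levi_civita_algebra g D nab.
Implicit Types (a b : A) (X Y Z W : V).

Let gE := gE L.
Let nE := nE L.

Lemma connform_rot (xi eta : V) X : g xi eta = 0 ->
  connform g nab eta (- xi) X = connform g nab xi eta X.
Proof.
move=> c12; have := Dg L X xi eta; rewrite c12 (D0 L) !connformE !gE => e.
by rewrite (gC L _ xi) (esym (addr0_eq (esym e))) opprK.
Qed.

(** A rotation by a right angle in the (U, V)-plane exchanges du with dv and S
    with T. Every statement about G therefore yields one about H. *)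
Lemma contact_pair_rot (xi eta : V) (G H : V -> V) :
  contact_pair g nab xi eta G H ->
  contact_pair g nab eta (- xi) H (fun Z => - G Z).
Proof.
case=> GD GZ HD HZ c11 c22 c12 G1 G2 H1 H2 GG HH HG Gs Hs du dv Sh Th Sv Tv.
have s' X := connform_rot X c12.
have GN X : G (- X) = - G X by rewrite -scaleN1r GZ scaleN1r.
have HN X : H (- X) = - H X by rewrite -scaleN1r HZ scaleN1r.
have horN X : is_horizontal g eta (- xi) X -> is_horizontal g xi eta X.
  by case=> h1 h2; split=> //; move: h2; rewrite !gE => /eqP; rewrite oppr_eq0 => /eqP.
have normalSN X Y : normalS g nab (- xi) (- eta) (fun Z => - G Z)
    (fun Z => - H Z) X Y = normalS g nab xi eta G H X Y.
  apply: (g_eq L) => W.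
  rewrite /normalS !nijenhuisE !covE !connformE.
  by do 3!rewrite ?(GN, HN, GD, HD) ?nE; rewrite !gE; ring.
have normalSNr X Y : normalS g nab xi eta G H X (- Y) = - normalS g nab xi eta G H X Y.
  apply: (g_eq L) => W.
  rewrite /normalS !nijenhuisE !covE !connformE.
  by do 3!rewrite ?(GN, HN, GD, HD) ?nE; rewrite !gE; ring.
split=> //.
- by move=> X Y; rewrite GD opprD.
- by move=> a X; rewrite GZ scalerN.
- by rewrite !gE opprK.
- by rewrite !gE (gC L) c12 oppr0.
- by rewrite HN H1 oppr0.
- by rewrite G2 oppr0.
- by rewrite GN G1 !oppr0.
- by move=> X; rewrite HH !gE scalerN scaleNr opprK addrAC.
- by move=> X; rewrite GN opprK GG !gE scalerN scaleNr opprK addrAC.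
- by move=> X; rewrite HN opprK HG.
- by move=> X Y; rewrite !gE Gs.
- by move=> X Y; rewrite dv !s' !gE; ring.
- by move=> X Y; rewrite !nE !gE !s' -opprD du; ring.
- by move=> X Y hX hY; apply: Th; apply: horN.
- by move=> X Y hX hY; rewrite normalSN; apply: Sh; apply: horN.
- by move=> X; rewrite normalSN normalSNr Sv oppr0.
Qed.

End NormalContactPair.

Section NormalContactPairTheory.
Context {A : comPzRingType} {V : lmodType A}.
Context {g : V -> V -> A} {D : V -> A -> A} {nab : V -> V -> V}.
Hypothesis L : levi_civita_algebra g D nab.
Context {xi eta : V} {G H : V -> V}.
Hypothesis C : contact_pair g nab xi eta G H.
Implicit Types (a b : A) (X Y Z W : V).

Let gE := gE L.
Let nE := nE L.
Let DE := DE L.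
Let gC := gC L.
Local Notation lie := (lie nab).
Local Notation curv := (curv nab).
Local Notation cov := (cov nab).
Local Notation sig := (connform g nab xi eta).
Local Notation hor := (is_horizontal g xi eta).

Let GD X Y : G (X + Y) = G X + G Y := cp_GD C X Y.
Let GZ a X : G (a *: X) = a *: G X := cp_GZ C a X.
Let HD X Y : H (X + Y) = H X + H Y := cp_HD C X Y.
Let HZ a X : H (a *: X) = a *: H X := cp_HZ C a X.
Let GN X : G (- X) = - G X. Proof. by rewrite -scaleN1r GZ scaleN1r. Qed.
Let HN X : H (- X) = - H X. Proof. by rewrite -scaleN1r HZ scaleN1r. Qed.
Let G0 : G 0 = 0. Proof. by apply: (addrI (G 0)); rewrite -GD !addr0. Qed.
Let H0 : H 0 = 0. Proof. by apply: (addrI (H 0)); rewrite -HD !addr0. Qed.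
Let G1 := cp_G1 C.
Let G2 := cp_G2 C.
Let H1 := cp_H1 C.
Let H2 := cp_H2 C.
Let e11 := cp_11 C.
Let e22 := cp_22 C.
Let e12 := cp_12 C.
Let e21 : g eta xi = 0. Proof. by rewrite gC. Qed.
Let eE := (e11, e22, e12, e21).
Let GHE := (GD, HD, GN, HN, GZ, HZ, G0, H0, G1, G2, H1, H2).
Let Gs X Y : g X (G Y) = - g (G X) Y := cp_Gskew C X Y.
Let Hs X Y : g X (H Y) = - g (H X) Y := cp_Hskew C X Y.
Let HG X : H (G X) = - G (H X) := cp_HG C X.
Let GG X : G (G X) = - X + g X xi *: xi + g X eta *: eta := cp_GG C X.
Let HH X : H (H X) = - X + g X xi *: xi + g X eta *: eta := cp_HH C X.

Lemma G_hor X : hor (G X).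
Proof.
by split; rewrite gC Gs ?G1 ?G2 !gE oppr0.
Qed.
Lemma H_hor X : hor (H X).
Proof. by split; rewrite gC Hs ?H1 ?H2 !gE oppr0. Qed.
Lemma GG_hor X : hor X -> G (G X) = - X.
Proof. by case=> h1 h2; rewrite GG h1 h2 !scale0r !addr0. Qed.
Lemma HH_hor X : hor X -> H (H X) = - X.
Proof. by case=> h1 h2; rewrite HH h1 h2 !scale0r !addr0. Qed.
(** On horizontal vectors G is a complex structure. *)
Lemma hor_G_inj X : hor X -> G X = 0 -> X = 0.
Proof. by move=> hX e; rewrite -[X]opprK -(GG_hor hX) e G0 oppr0. Qed.

Definition hproj X := locked (X - g X xi *: xi - g X eta *: eta).
Lemma hprojE X : hproj X = X - g X xi *: xi - g X eta *: eta.
Proof. by rewrite /hproj -lock. Qed.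
Lemma hproj_hor X : hor (hproj X).
Proof. by split; rewrite !hprojE !gE !eE; ring. Qed.
Lemma hproj_split X : X = hproj X + g X xi *: xi + g X eta *: eta.
Proof. by rewrite !hprojE -addrA [X in _ = _ + X]addrC addrA !subrK. Qed.

Lemma nab_xi_xi X : g (nab X xi) xi = 0.
Proof. by apply: (two_regular L); rewrite mulr2n -{2}(gC xi) -(Dg L) e11 (D1 L). Qed.
Lemma nab_eta_xi X : g (nab X eta) xi = - sig X.
Proof.
rewrite connformE.
have := Dg L X xi eta; rewrite e12 (D0 L) (gC xi) => e.
by rewrite -(addr0_eq (esym e)).
Qed.
Lemma sigE X : g (nab X xi) eta = sig X. Proof. by rewrite connformE. Qed.

(** Insert [xi] in the structure equation for du. *)
Lemma nab_xi_along_xi : nab xi xi = sig xi *: eta.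
Proof.
apply: (g_eq L) => Y; rewrite gE.
have := cp_du C xi Y; rewrite nab_xi_xi subr0 Gs G1 !gE e12 (gC eta) => ->.
by ring.
Qed.
Lemma nab_xi_along_eta : nab eta xi = sig eta *: eta.
Proof.
apply: (g_eq L) => Y; rewrite gE.
have := cp_du C eta Y; rewrite sigE Gs G2 !gE e22 (gC eta) => /eqP.
rewrite subr_eq => /eqP ->.
by ring.
Qed.

Lemma covG_skew X Y Z : g (cov G X Y) Z = - g Y (cov G X Z).
Proof.
have := Dg L X (G Y) Z; rewrite -[g (G Y) Z]opprK -Gs DE (Dg L) => e.
rewrite !covE !gE !Gs; rewrite Gs opprD in e.
transitivity (g (nab X (G Y)) Z + g (G Y) (nab X Z) - g (G Y) (nab X Z)
   + g (nab X Y) (G Z)); first by rewrite !Gs; ring.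
by rewrite -e Gs; ring.
Qed.

Lemma covG_dot_xi X Y : g (cov G X Y) xi = - g (G Y) (nab X xi).
Proof. by rewrite covG_skew !covE G1 (n0r L) !gE add0r Gs opprK. Qed.
Lemma covG_dot_eta X Y : g (cov G X Y) eta = - g (G Y) (nab X eta).
Proof. by rewrite covG_skew !covE G2 (n0r L) !gE add0r Gs opprK. Qed.
Lemma covG_of_xi X : cov G X xi = - G (nab X xi).
Proof. by rewrite !covE G1 (n0r L) add0r. Qed.
Lemma covG_of_eta X : cov G X eta = - G (nab X eta).
Proof. by rewrite !covE G2 (n0r L) add0r. Qed.

(** The difference between [nab X xi] and its value in the normal case. The
    structure equation for du only says that it is symmetric; that it vanishes
    is where normality enters ([shape_eq0]). *)
Definition shape X := locked (sig X *: eta - G X - nab X xi).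
Lemma shapeE X : shape X = sig X *: eta - G X - nab X xi.
Proof. by rewrite /shape -lock. Qed.

Lemma nab_xiE X : nab X xi = sig X *: eta - G X - shape X.
Proof. by rewrite !shapeE opprB addrC subrK. Qed.
Lemma shape_sym X Y : g (shape X) Y = g (shape Y) X.
Proof.
have := cp_du C X Y; rewrite Gs => e.
rewrite !shapeE !gE (gC (G Y)) Gs; apply/subr0_eq.
rewrite -[RHS](subrr (g (nab X xi) Y - g (nab Y xi) X)) {1}e.
by rewrite (gC eta) (gC eta); ring.
Qed.
Lemma shape_hor X : hor (shape X).
Proof.
have [h1 h2] := G_hor X.
by split; rewrite !shapeE !gE ?h1 ?h2 ?nab_xi_xi ?sigE !eE; ring.
Qed.
Lemma shape_xi : shape xi = 0.
Proof. by rewrite !shapeE G1 nab_xi_along_xi subr0 subrr. Qed.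
Lemma shape_eta : shape eta = 0.
Proof. by rewrite !shapeE G2 nab_xi_along_eta subr0 subrr. Qed.
Lemma shapeD X Y : shape (X + Y) = shape X + shape Y.
Proof. by apply: (g_eq L) => W; rewrite !shapeE !connformE !GHE !nE !gE; ring. Qed.
Lemma shapeZ a X : shape (a *: X) = a *: shape X.
Proof. by apply: (g_eq L) => W; rewrite !shapeE !connformE !GHE !nE !gE; ring. Qed.

Lemma nab_eta_along_xi : nab xi eta = - sig xi *: xi.
Proof.
apply: (g_eq L) => Y; rewrite gE.
have := cp_dv C xi Y; rewrite nab_eta_xi Hs H1 !gE e11 (gC xi) => /eqP.
rewrite subr_eq => /eqP ->.
by ring.
Qed.

(** This is the equation [S (X, xi) = 0], with [G] cancelled. *)
Lemma covG_along_xi_shape X :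
  cov G xi X - sig xi *: H X = G (shape X) - shape (G X).
Proof.
apply/subr0_eq; apply: hor_G_inj.
  have [h1 h2] := H_hor X; have [h3 h4] := G_hor (shape X).
  have [h5 h6] := shape_hor (G X); have [h7 h8] := G_hor X.
  split; rewrite !gE ?covG_dot_xi ?covG_dot_eta ?h1 ?h2 ?h3 ?h4 ?h5 ?h6
    ?nab_xi_along_xi ?nab_eta_along_xi ?gE ?h7 ?h8; ring.
rewrite -[RHS](cp_S_vert C X) /normalS nijenhuisE !covG_of_xi !nab_xiE.
have -> : cov G (G xi) X = 0 by rewrite !covE G1 !nE G0 subr0.
have -> : sig (G xi) = 0 by rewrite !connformE G1 nE gE.
apply: (g_eq L) => W; rewrite !GHE !gE !eE; ring.
Qed.

(** The closedness of du, together with the structure equations: the part of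
    [cov G] that is not [sig] times H has vanishing cyclic sum on ker v. *)
Lemma cyclic_defect X Y Z : g X eta = 0 -> g Y eta = 0 -> g Z eta = 0 ->
  (g (cov G X Y) Z - sig X * g (H Y) Z)
  + (g (cov G Y Z) X - sig Y * g (H Z) X)
  + (g (cov G Z X) Y - sig Z * g (H X) Y) = 0.
Proof.
move=> hX hY hZ; apply: (two_regular L).
have nG X' Y' : nab X' (G Y') = cov G X' Y' + G (nab X' Y').
  by rewrite covE subrK.
have := exterior_derivative_exact L X Y Z xi; cbv zeta beta.
rewrite !(cp_du C) !mulr2n !DE !(Dg L) !nG !gE !Gs ?hX ?hY ?hZ.
have dv X' Y' : g X' (nab Y' eta) = g Y' (nab X' eta) - g X' (H Y') *+ 2
   + (sig X' * g Y' xi - sig Y' * g X' xi).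
  have := cp_dv C X' Y'; rewrite (gC _ X') (gC _ Y') => /eqP.
  by rewrite subr_eq => /eqP ->; ring.
rewrite (dv Y X) (dv Z Y) (dv X Z) !mulr2n !Hs.
rewrite (gC (H Y) X) (gC (H Z) Y) (gC (H X) Z) !Hs => e.
rewrite !covG_skew; apply/eqP; rewrite -oppr_eq0 -[X in _ == X]e; apply/eqP.
ring.
Qed.

Lemma hproj_ind (P : V -> Prop) :
  (forall X Y, P X -> P Y -> P (X + Y)) -> (forall a X, P X -> P (a *: X)) ->
  P xi -> P eta -> (forall X, hor X -> P X) -> forall X, P X.
Proof.
move=> PD PZ P1 P2 Ph X; rewrite [X]hproj_split.
exact: PD (PD _ _ (Ph _ (hproj_hor X)) (PZ _ _ P1)) (PZ _ _ P2).
Qed.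

(** Take the cyclic identity at (xi, Y, Z) with Y, Z horizontal. Its first term is
    known from [S (Y, xi) = 0], the others from [nab_xiE], and what remains is
    twice the product of [shape (G Y)] with Z. *)
Lemma shape_eq0 X : shape X = 0.
Proof.
have key Y Z : hor Y -> hor Z -> g (shape (G Y)) Z = 0.
  move=> hY hZ; apply: (two_regular L).
  have [hY1 hY2] := hY; have [hZ1 hZ2] := hZ.
  have := cyclic_defect e12 hY2 hZ2.
  have /eqP := covG_along_xi_shape Y; rewrite subr_eq => /eqP ->.
  rewrite covG_dot_xi covG_of_xi !nab_xiE H1 !GHE (GG_hor hZ) !gE.
  have [_ ->] := G_hor Z; have [-> _] := H_hor Z.
  have -> : g (G (shape Y)) Z = - g (shape Y) (G Z) by rewrite Gs opprK.
  have -> : g (G (shape Z)) Y = - g (shape (G Y)) Z.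
    by rewrite (shape_sym (G Y)) Gs opprK.
  rewrite (gC (G Z) (G Y)) (Gs (G Y)) (GG_hor hY) (gC (G Z)) (gC Z Y) !gE => e.
  by apply/eqP; rewrite -oppr_eq0 -[X in _ == X]e; apply/eqP; ring.
have hor0 Y : hor Y -> shape Y = 0.
  move=> hY; apply: (g_eq L) => Z; rewrite gE [Z]hproj_split !gE.
  have [h1 h2] := shape_hor Y; rewrite h1 h2 !mulr0 !addr0.
  rewrite -[Y]opprK -(GG_hor hY) -scaleN1r shapeZ gE key ?mulr0 //.
  - exact: G_hor.
  - exact: hproj_hor.
elim/hproj_ind: X => [X Y eX eY|a X eX|||] //.
- by rewrite shapeD eX eY addr0.
- by rewrite shapeZ eX scaler0.
- exact: shape_xi.
- exact: shape_eta.
Qed.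

Lemma nab_xi X : nab X xi = sig X *: eta - G X.
Proof. by rewrite nab_xiE shape_eq0 subr0. Qed.

Lemma covG_along_xi X : cov G xi X = sig xi *: H X.
Proof. by apply/subr0_eq; rewrite covG_along_xi_shape !shape_eq0 G0 subr0. Qed.

(** Differentiate the square of G, which is minus the identity on horizontal
    vectors. *)
Lemma covG_GZ X Y Z : hor Y -> hor Z ->
  g (cov G X (G Y)) Z = g (cov G X Y) (G Z).
Proof.
move=> hY [h1 h2]; rewrite Gs !covE (GG_hor hY) !nE !GHE GG !gE (gC xi) (gC eta) h1 h2.
by ring.
Qed.

(** Let a (X; Y, Z) be the difference of the two sides. It is skew in Y, Z, its
    cyclic sum vanishes, and G can be moved from Y to Z. With these symmetries
    the equation [S (X', Y') = 0] paired with X collapses to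
    2 a (X; G X', Y') = 0, and G is onto the horizontal vectors. *)
Lemma covG_hor X Y Z : hor X -> hor Y -> hor Z ->
  g (cov G X Y) Z = sig X * g (H Y) Z.
Proof.
move=> hX hY hZ; have hGX := G_hor X; have hGY := G_hor Y; have hGZ := G_hor Z.
have [_ hX2] := hX; have [_ hY2] := hY; have [_ hZ2] := hZ.
pose a X Y Z := g (cov G X Y) Z - sig X * g (H Y) Z.
have aG X' Y' Z' : hor Y' -> hor Z' -> a X' (G Y') Z' = a X' Y' (G Z').
  by move=> hY' hZ'; rewrite /a covG_GZ // (Gs (H Y')) HG !gE.
have aC X' Y' Z' : a X' Y' Z' = - a X' Z' Y'.
  by rewrite /a covG_skew (gC (H Z')) Hs (gC Y'); ring.
have cyc X' Y' Z' : hor X' -> hor Y' -> hor Z' ->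
    a X' Y' Z' = - a Y' Z' X' - a Z' X' Y'.
  move=> [_ hX'] [_ hY'] [_ hZ']; have := cyclic_defect hX' hY' hZ'.
  rewrite -/(a _ _ _) -/(a _ _ _) -/(a _ _ _) -addrA => /eqP.
  by rewrite addr_eq0 opprD => /eqP.
have key X' Y' : hor X' -> hor Y' -> a X (G X') Y' = 0.
  move=> hX' hY'; apply: (two_regular L).
  have hGX' := G_hor X'; have hGY' := G_hor Y'.
  have := congr1 (g^~ X) (cp_S_hor C hX' hY').
  rewrite /normalS nijenhuisE !gE.
  have [u1 v1] := hX'; have [u2 v2] := hY'; have [u3 v3] := hX.
  rewrite !(gC eta) v1 v2 (gC xi) u3 v3.
  have gG W : g (G W) X = - g W (G X) by rewrite Gs opprK.
  (* Now rewrite S = 0 in terms of a; the sigma terms cancel. *)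
  have covGE X'' Y'' Z'' : g (cov G X'' Y'') Z'' = a X'' Y'' Z'' + sig X'' * g (H Y'') Z''.
    by rewrite /a subrK.
  rewrite !gG !covGE => e.
  have : a (G X') Y' X - a (G Y') X' X + a X' Y' (G X) - a Y' X' (G X) = 0.
    by rewrite -[RHS]e; ring.
  rewrite (cyc (G X')) // (cyc (G Y')) //.
  have -> : a Y' X (G X') = - a Y' X' (G X) by rewrite -aG // aC.
  have -> : a X' X (G Y') = - a X' Y' (G X) by rewrite -aG // aC.
  have -> : a X (G Y') X' = - a X (G X') Y' by rewrite aC -aG.
  by move/eqP; rewrite -oppr_eq0 => /eqP <-; ring.
apply/subr0_eq; rewrite -/(a X Y Z).
have -> : Y = G (G (- Y)) by rewrite !GN (GG_hor hY) opprK.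
exact: key (G_hor _) hZ.
Qed.
End NormalContactPairTheory.

(** * Curvature of a normal contact pair *)

Section NormalContactCurvature.
Context {A : comPzRingType} {V : lmodType A}.
Context {g : V -> V -> A} {D : V -> A -> A} {nab : V -> V -> V}.
Hypothesis L : levi_civita_algebra g D nab.
Context {xi eta : V} {G H : V -> V}.
Hypothesis C : contact_pair g nab xi eta G H.
Implicit Types (a b : A) (X Y Z W : V).

Let C' := contact_pair_rot L C.
Let gE := gE L.
Let nE := nE L.
Let DE := DE L.
Let gC := gC L.
Local Notation lie := (lie nab).
Local Notation curv := (curv nab).
Local Notation cov := (cov nab).
Local Notation sig := (connform g nab xi eta).
Local Notation hor := (is_horizontal g xi eta).

Let GHE := (cp_GD C, cp_HD C, cp_GZ C, cp_HZ C, cp_G1 C, cp_G2 C, cp_H1 C, cp_H2 C).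
Let GHN : (forall X, G (- X) = - G X) * (forall X, H (- X) = - H X).
Proof. by split=> X; rewrite -scaleN1r !GHE scaleN1r. Qed.
Let e11 := cp_11 C.
Let e22 := cp_22 C.
Let e12 := cp_12 C.
Let e21 : g eta xi = 0. Proof. by rewrite gC. Qed.
Let eE := (e11, e22, e12, e21).
Let Gs X Y : g X (G Y) = - g (G X) Y := cp_Gskew C X Y.
Let Hs X Y : g X (H Y) = - g (H X) Y := cp_Hskew C X Y.
Let HG X : H (G X) = - G (H X) := cp_HG C X.

Lemma sig_rot X : connform g nab eta (- xi) X = sig X.
Proof. by rewrite connformE gE (nab_eta_xi L C) opprK. Qed.

Lemma hor_rot X : hor X -> is_horizontal g eta (- xi) X.
Proof. by case=> h1 h2; split; rewrite ?gE ?h1 ?oppr0. Qed.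

Lemma nab_eta X : nab X eta = - (sig X *: xi) - H X.
Proof. by rewrite (nab_xi L C') sig_rot scalerN. Qed.

Lemma covH_hor X Y Z : hor X -> hor Y -> hor Z ->
  g (cov H X Y) Z = - (sig X * g (G Y) Z).
Proof.
move=> hX hY hZ; rewrite (covG_hor L C') ?sig_rot ?gE ?mulrN //; exact: hor_rot.
Qed.

(** The vertical components come from [nab xi] and [nab eta] by skewness. *)
Lemma covG_hor_hor Y Z : hor Y -> hor Z ->
  cov G Y Z = sig Y *: H Z + g Y Z *: xi - g (G (H Y)) Z *: eta.
Proof.
move=> hY hZ; apply: (g_eq L) => W; rewrite [W](@hproj_split _ _ g xi eta W).
have hW := hproj_hor L C W.
have [w1 w2] := hW; have [h1 h2] := H_hor L C Z.
set W1 := hproj _ in hW w1 w2 *.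
rewrite !gE (covG_hor L C) // (covG_dot_xi L C) (covG_dot_eta L C) !(gC xi) !(gC eta).
rewrite (nab_xi L C) nab_eta !gE !eE w1 w2 h1 h2.
have [-> ->] := G_hor L C Z.
have [h3 h4] := hZ.
rewrite (gC (G Z) (G Y)) (gC (G Z) (H Y)) !Gs (GG_hor C hY) !gE; ring.
Qed.

(** The derivative of G along [eta] is not determined by the structure equations.
    This endomorphism, P below, is the part left free; it also determines the
    exterior derivative of sigma ([dsigma_hor]). *)
Definition vdefect Z : V := locked (cov G eta Z - sig eta *: H Z).
Local Notation P := vdefect.
Lemma vdefectE Z : P Z = cov G eta Z - sig eta *: H Z.
Proof. by rewrite /vdefect -lock. Qed.
Lemma vdefect_hor Z : hor (P Z).
Proof.
have [h1 h2] := H_hor L C Z; have [h3 h4] := G_hor L C Z.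
split; rewrite vdefectE !gE ?h1 ?h2 ?(covG_dot_xi L C) ?(covG_dot_eta L C)
  (nab_xi L C, nab_eta) ?GHE !gE ?h3 ?h4; ring.
Qed.
Lemma vdefect_skew Y Z : g Y (P Z) = - g (P Y) Z.
Proof. by rewrite !vdefectE !gE (covG_skew L C) Hs; ring. Qed.

Lemma hor_eq X Y : hor X -> hor Y -> (forall W, hor W -> g X W = g Y W) -> X = Y.
Proof.
move=> [hX1 hX2] [hY1 hY2] e; apply: (g_eq L) => W.
rewrite [W](@hproj_split _ _ g xi eta W) !gE hX1 hX2 hY1 hY2 e //.
exact: (hproj_hor L C W).
Qed.

Lemma vdefect_G Z : hor Z -> G (P Z) = - P (G Z).
Proof.
move=> hZ; apply: hor_eq; first exact: (G_hor L C _).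
  by have [h1 h2] := vdefect_hor (G Z); split; rewrite gE ?h1 ?h2 oppr0.
move=> W hW; rewrite gE -[LHS]opprK -Gs; congr (- _).
rewrite !vdefectE !gE (covG_GZ L C) // Gs HG !gE Gs; ring.
Qed.

Let covDr T X Y Z : (forall X Y, T (X + Y) = T X + T Y) ->
  cov T X (Y + Z) = cov T X Y + cov T X Z.
Proof. by move=> TD; apply: (g_eq L) => W; rewrite !covE !(TD, nE) !gE; ring. Qed.

Lemma covG_along_hor X Z W : hor X -> hor W ->
  g (cov G X Z) W = sig X * g (H Z) W - g Z xi * g X W + g Z eta * g (G (H X)) W.
Proof.
move=> hX hW; rewrite [in LHS](@hproj_split _ _ g xi eta Z).
have covZ a Y : cov G X (a *: Y) = a *: cov G X Y.
  by apply: (g_eq L) => W'; rewrite !covE !(GHE, nE) !gE; ring.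
rewrite !covDr ?covZ; try exact: cp_GD C.
rewrite !gE (covG_hor L C) //; last exact: (hproj_hor L C Z).
rewrite (covG_of_xi L C) (covG_of_eta L C) (nab_xi L C) nab_eta hprojE.
rewrite !(GHE, GHN) !gE (GG_hor C hX) !gE; ring.
Qed.

Lemma covG_on_hor X Z W : hor Z -> hor W ->
  g (cov G X Z) W = sig X * g (H Z) W + g X eta * g (P Z) W.
Proof.
move=> hZ hW; rewrite [in LHS](@hproj_split _ _ g xi eta X).
have covDl Y Y' : cov G (Y + Y') Z = cov G Y Z + cov G Y' Z.
  by apply: (g_eq L) => W'; rewrite !covE !(GHE, nE) !gE; ring.
have covZl a Y : cov G (a *: Y) Z = a *: cov G Y Z.
  by apply: (g_eq L) => W'; rewrite !covE !(GHE, nE) !gE; ring.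
have sigE : sig X = sig (@hproj _ _ g xi eta X) + g X xi * sig xi + g X eta * sig eta.
  by rewrite {1}(@hproj_split _ _ g xi eta X) !connformE !nE !gE.
rewrite !(covDl, covZl) !gE (covG_hor L C) //; last exact: (hproj_hor L C X).
rewrite (covG_along_xi L C) sigE vdefectE !gE; ring.
Qed.

(** Twice the exterior derivative of sigma. *)
Definition dsigma X Y : A := locked (D X (sig Y) - D Y (sig X) - sig (lie X Y)).
Lemma dsigmaE X Y : dsigma X Y = D X (sig Y) - D Y (sig X) - sig (lie X Y).
Proof. by rewrite /dsigma -lock. Qed.

Lemma hor_nab_xi X Z : hor Z -> g (nab X Z) xi = g Z (G X).
Proof.
move=> [h1 h2]; have := Dg L X Z xi.
by rewrite h1 (D0 L) (nab_xi L C) !gE h2 => /esym/eqP; rewrite addr_eq0 => /eqP ->; ring.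
Qed.
Lemma hor_nab_eta X Z : hor Z -> g (nab X Z) eta = g Z (H X).
Proof.
move=> [h1 h2]; have := Dg L X Z eta.
by rewrite h2 (D0 L) nab_eta !gE h1 => /esym/eqP; rewrite addr_eq0 => /eqP ->; ring.
Qed.

(** The Ricci identity for G: differentiate [cov G] once more, using
    [covG_hor_hor], [covG_along_hor] and [covG_on_hor] for its components. *)
Lemma curv_comm_G X Y Z W : hor X -> hor Y -> hor Z -> hor W ->
  g (curv X Y (G Z)) W = g (G (curv X Y Z)) W
  + dsigma X Y * g (H Z) W
  - g Y Z * g (G X) W + g X Z * g (G Y) W
  + g (G (H Y)) Z * g (H X) W - g (G (H X)) Z * g (H Y) W
  + g (G X) Z * g Y W - g (G Y) Z * g X W
  - g (H X) Z * g (G (H Y)) W + g (H Y) Z * g (G (H X)) W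
  - g (H X) Y * g (P Z) W *+ 2.
Proof.
move=> hX hY hZ hW; have [w1 w2] := hW.
have nG X' Y' : nab X' (G Y') = cov G X' Y' + G (nab X' Y') by rewrite covE subrK.
have nH X' Y' : nab X' (H Y') = cov H X' Y' + H (nab X' Y') by rewrite covE subrK.
rewrite !curvE !nG !nE !nG !GHE !GHN !gE.
rewrite (covG_on_hor (lie X Y)) // (covG_hor_hor hY hZ) (covG_hor_hor hX hZ).
rewrite !nE !nH !gE !covH_hor //.
rewrite !covG_along_hor // !hor_nab_xi // !hor_nab_eta //.
have -> : g (lie X Y) eta = g (H X) Y *+ 2.
  by rewrite lieE !gE !hor_nab_eta // (Hs X) (gC Y); ring.
rewrite !(nab_xi L C) !nab_eta !gE !(gC xi) !(gC eta) w1 w2 dsigmaE.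
by rewrite !(gC Z); ring.
Qed.

Lemma curv_xi X Y :
  curv X Y xi = cov G Y X - cov G X Y + dsigma X Y *: eta
    - sig Y *: H X + sig X *: H Y.
Proof.
have nG X' Y' : nab X' (G Y') = cov G X' Y' + G (nab X' Y') by rewrite covE subrK.
rewrite curvE dsigmaE !(nab_xi L C) !nE !nG !nab_eta; apply: (g_eq L) => W.
rewrite lieE !(GHE, GHN) !gE; ring.
Qed.

(** Both sides are values of the curvature on X, Y, xi, eta: the left one appears
    in [curv_xi] directly, the right one after the first Bianchi identity. *)
Lemma dsigma_hor X Y : hor X -> hor Y ->
  dsigma X Y = g (P X) Y *+ 2 - g (G (H X)) Y *+ 4.
Proof.
move=> hX hY.
have [x1 x2] := hX; have [y1 y2] := hY.
have [hx1 hx2] := H_hor L C X; have [hy1 hy2] := H_hor L C Y.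
have xi_eta X' Y' : hor X' -> hor Y' ->
    g (curv X' eta xi) Y' = g (P X') Y' - g (G (H X')) Y'.
  move=> [u1 u2] [v1 v2].
  rewrite curv_xi (covG_of_eta L C) nab_eta !(GHE, GHN) !gE (gC eta) v2 vdefectE !gE.
  by ring.
have := bianchi_g L X Y eta xi.
rewrite !(curv34 L _ _ _ xi) (curv12 L X eta) !gE !xi_eta //.
rewrite curv_xi !covG_hor_hor // !gE hx2 hy2 !eE.
rewrite (gC (G (H Y)) X) Gs Hs HG (gC (P Y) X) vdefect_skew !gE => e.
apply/eqP; rewrite -subr_eq0 -oppr_eq0 -[X in _ == X]e; apply/eqP; ring.
Qed.

(** Apply [curv_comm_G] to the last pair of arguments, exchange the pairs, apply it
    again and exchange back. The purely metric terms of the two applications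
    cancel, and [dsigma_hor] turns the others into products of two metric
    factors. *)
Lemma curv_GGGG X Y Z W : hor X -> hor Y -> hor Z -> hor W ->
  g (curv (G X) (G Y) (G Z)) (G W) = g (curv X Y Z) W
   + (g (P X) Y * g (G (H Z)) W - g (P Z) W * g (G (H X)) Y
      - g (H X) Y * g (G (P Z)) W + g (H Z) W * g (G (P X)) Y) *+ 2.
Proof.
move=> hX hY hZ hW.
have hG T := G_hor L C T; have hH T := H_hor L C T; have hP := vdefect_hor.
have gGG T : g (G T) (G W) = g T W.
  by rewrite Gs (cp_GG C) !gE; have [w1 w2] := hW; rewrite !(gC _ W) w1 w2; ring.
have gGGY T : g (G T) (G Y) = g T Y.
  by rewrite Gs (cp_GG C) !gE; have [w1 w2] := hY; rewrite !(gC _ Y) w1 w2; ring.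
rewrite curv_comm_G // gGG (curv_pair L (G X)) curv_comm_G // gGGY (curv_pair L Z).
rewrite !dsigma_hor // !HG !GHN -(opprK (P (G X))) -vdefect_G //.
rewrite !(GG_hor C hX, GG_hor C hY, GG_hor C (hH X), GG_hor C (hH Y)) !gE.
rewrite !gGG !gGGY !Gs !(gC _ X) !Gs !Hs !HG !gE.
rewrite !(gC Z Y, gC W Y, gC (H Z) Y, gC (H W) Y) !Hs.
rewrite !(gC (G Z) Y, gC (G W) Y, gC (G (H Z)) Y, gC (G (H W)) Y) !Gs !Hs !HG !gE.
ring.
Qed.

(** The sectional curvature of a plane that contains [xi] and a horizontal vector
    is 1. *)
Lemma curv_xi_xi Y Z : hor Y -> hor Z -> g (curv xi Y Z) xi = g Y Z.
Proof.
move=> hY [_ h2].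
rewrite (curv34 L) (curv12 L) gE opprK curv_xi (covG_along_xi L C) (covG_of_xi L C).
rewrite (nab_xi L C) !(GHE, GHN) (GG_hor C hY) !gE (gC eta) h2; ring.
Qed.
End NormalContactCurvature.

(** * Invariance of the Ricci tensor *)

Section RicciInvariance.
Context {A : comPzRingType} {V : lmodType A}.
Context {g : V -> V -> A} {D : V -> A -> A} {nab : V -> V -> V}.
Hypothesis L : levi_civita_algebra g D nab.
Context {m : nat} {E : 'I_m -> V}.
Hypothesis frameE : forall X, X = \sum_a g X (E a) *: E a.
Implicit Types (a b : A) (X Y Z W : V).

Let gE := gE L.
Let gC := gC L.

Definition ricci Y Z : A := \sum_a g (curv nab (E a) Y Z) (E a).

Lemma frame_sum X Y : \sum_a g (E a) X * g (E a) Y = g X Y.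
Proof.
rewrite [X in RHS]frameE (g_suml L); apply: eq_bigr => a _.
by rewrite gE (gC X).
Qed.

Section Bilinear.
Variable B : V -> V -> A.
Hypothesis BDl : forall X Y Z, B (X + Y) Z = B X Z + B Y Z.
Hypothesis BZl : forall a X Y, B (a *: X) Y = a * B X Y.
Hypothesis BDr : forall X Y Z, B Z (X + Y) = B Z X + B Z Y.
Hypothesis BZr : forall a X Y, B Y (a *: X) = a * B Y X.

Lemma frame_expand_l X Y : B X Y = \sum_a g (E a) X * B (E a) Y.
Proof.
have B0 : B 0 Y = 0 by rewrite -(scale0r 0) BZl mul0r.
rewrite {1}[X]frameE (big_morph (B^~ Y) (fun X X' => BDl X X' Y) B0).
by apply: eq_bigr => a _; rewrite BZl gC.
Qed.

Lemma frame_expand_r X Y : B X Y = \sum_a g (E a) Y * B X (E a).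
Proof.
have B0 : B X 0 = 0 by rewrite -(scale0r 0) BZr mul0r.
rewrite {1}[Y]frameE (big_morph (B X) (fun Y Y' => BDr Y Y' X) B0).
by apply: eq_bigr => a _; rewrite BZr gC.
Qed.
End Bilinear.

Context {xi eta : V} {G H : V -> V}.
Hypothesis C : contact_pair g nab xi eta G H.
Local Notation hor := (is_horizontal g xi eta).
Let GHE := (cp_GD C, cp_HD C, cp_GZ C, cp_HZ C, cp_G1 C, cp_G2 C, cp_H1 C, cp_H2 C).
Let GN X : G (- X) = - G X. Proof. by rewrite -scaleN1r !GHE scaleN1r. Qed.

Section TraceG.
Variable B : V -> V -> A.
Hypothesis BDl : forall X Y Z, B (X + Y) Z = B X Z + B Y Z.
Hypothesis BZl : forall a X Y, B (a *: X) Y = a * B X Y.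
Hypothesis BDr : forall X Y Z, B Z (X + Y) = B Z X + B Z Y.
Hypothesis BZr : forall a X Y, B Y (a *: X) = a * B Y X.

(** Move one G across the trace: it is skew, and its square is minus the projection
    to the horizontal vectors. *)
Lemma trace_G : \sum_a B (E a) (E a) =
  \sum_a B (G (E a)) (G (E a)) + B xi xi + B eta eta.
Proof.
have BNr X Y : B X (- Y) = - B X Y by rewrite -scaleN1r BZr mulN1r.
transitivity (\sum_a (- B (E a) (G (G (E a))) + g (E a) xi * B (E a) xi
    + g (E a) eta * B (E a) eta)).
  by apply: eq_bigr => a _; rewrite (cp_GG C) !(BDr, BZr, BNr); ring.
rewrite !big_split /= -!(frame_expand_l BDl BZl); congr (_ + _ + _).
transitivity (\sum_a \sum_b - (g (E b) (G (E a)) * B (E a) (G (E b)))).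
  apply: eq_bigr => a _; rewrite sumrN; congr (- _).
  by apply: (@frame_expand_r (fun X Y => B X (G Y))) => [X Y Z|b X Y]; rewrite !GHE (BDr, BZr).
rewrite exchange_big; apply: eq_bigr => a _.
rewrite (frame_expand_l BDl BZl (G (E a))); apply: eq_bigr => b _.
by rewrite (cp_Gskew C) (gC (G _)) mulNr opprK.
Qed.
End TraceG.

Local Notation P := (@vdefect A V g nab xi eta G H).

(** By [trace_G] and [curv_xi_xi] the Ricci tensor is the trace over G-images, which
    are horizontal, plus twice the metric. Over the vectors G (G E_a) the first
    part is given by [curv_GGGG]; the trace of the four correction terms
    vanishes because P is skew and anticommutes with G. *)
Lemma ricci_GG Y Z : hor Y -> hor Z -> ricci (G Y) (G Z) = ricci Y Z.
Proof.
move=> hY hZ.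
have C' := contact_pair_rot L C.
have hG T := G_hor L C T; have hH T := H_hor L C T; have hP := vdefect_hor L C.
have tr Y' Z' := @trace_G (fun X W => g (curv nab X Y' Z') W)
  (fun X X' W => etrans (congr1 (g^~ W) (curvDl L X X' Y' Z')) (gDl L _ _ _))
  (fun a X W => etrans (congr1 (g^~ W) (curvZl L a X Y' Z')) (gZl L _ _ _))
  (fun W W' X => gDr L W W' _) (fun a W X => gZr L a W _).
have vert Y' Z' : hor Y' -> hor Z' ->
    g (curv nab xi Y' Z') xi + g (curv nab eta Y' Z') eta = g Y' Z' *+ 2.
  move=> hY' hZ'; rewrite (curv_xi_xi L C) // (curv_xi_xi L C') //; exact: (hor_rot L).
rewrite /ricci !tr -!addrA !vert //.
rewrite (gC (G Y)) (cp_Gskew C) (GG_hor C hZ) gE opprK (gC Z); congr (_ + _).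
rewrite (@trace_G (fun X W => g (curv nab (G X) (G Y) (G Z)) (G W)));
  try by move=> *; rewrite !GHE ?(curvDl L) ?(curvZl L) !gE.
rewrite !(cp_G1 C) !(cp_G2 C) !gE !addr0.
under eq_bigr do rewrite (curv_GGGG L C (hG _) hY hZ (hG _)).
rewrite big_split /= -[RHS]addr0; congr (_ + _).
(* Horizontal trace of a product of two metric factors. *)
have trGG S T : hor T -> \sum_a g (G (E a)) S * g (G (E a)) T = g S T.
  move=> hT; transitivity (g (G S) (G T)).
    rewrite -frame_sum; apply: eq_bigr => a _.
    by rewrite !(cp_Gskew C) mulrNN.
  by rewrite (gC S) (gC (G S)) (cp_Gskew C) (GG_hor C hT) gE opprK.
have Gs X W : g (G X) W = - g X (G W) by rewrite (cp_Gskew C) opprK.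
have Hs X W : g (H X) W = - g X (H W) by rewrite (cp_Hskew C) opprK.
have Ps := vdefect_skew L C.
have Pr S W : g (P S) W = - g S (P W) by rewrite Ps opprK.
(* Each factor is moved into the form g (G E_a) S, so that [trGG] applies. *)
rewrite sumrMnl (eq_bigr (fun i => - (g (G (E i)) (P Y) * g (G (E i)) (G (H Z)))
  - g (G (E i)) (P Z) * g (G (E i)) (H (G Y))
  + g (G (E i)) (G (P Z)) * g (G (E i)) (H Y)
  + g (G (E i)) (P (G Y)) * g (G (E i)) (H Z))); last first.
  move=> i _; move: (G (E i)) => X.
  rewrite !(gC _ X) (gC (G (P X))) (gC (G (H X))) (gC (H X)) (gC (P X)).
  rewrite !(cp_Gskew C) !(gC _ (H X)) !(gC _ (P X)) !Hs !Pr; ring.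
rewrite !big_split /= !sumrN !trGG; try exact: hG; try exact: hH.
rewrite -[P (G Y)]opprK -(vdefect_G L C) // (cp_HG C) !gE (gC (P Y)) (gC (P Z)).
rewrite (gC (G (P Y))) (gC (G (P Z))) (Gs (H Z)) (Gs (H Y)); ring.
Qed.
End RicciInvariance.

(** * Functions of class C^k *)

Section CkTheory.
Context {R : realType}.
Implicit Types U V W : normedModType R.

Lemma near_eq_differentiable V W (f h : V -> W) (x : V) :
  (\forall y \near x, f y = h y) -> differentiable f x -> differentiable h x.
Proof.
move=> fh df; have -> : h = f + (h - f) by rewrite addrC subrK.
apply: differentiableD => //.
have k0 : \forall y \near x, (h - f) y = 0.
  by near=> y; rewrite !fctE (near fh y) ?subrr.
apply/diff_locallyP; set k := h - f in k0 *.
have kx : k x = 0 by exact: (nbhs_singleton k0).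
have E : k \o shift x = cst (k x) + (\0 : V -> W) +o_ (0 : V) id.
  apply/eqaddoP => e e0; near=> y.
  rewrite !fctE kx addr0 subr0 /=.
  rewrite (_ : k (y + x) = 0) ?normr0 ?mulr_ge0 ?(ltW e0) //.
  near: y; move: k0; rewrite (near_shift 0 x) /=; apply: filterS => y /=.
  by rewrite subr0.
have dk : 'd k x = (\0 : V -> W) :> (V -> W).
  by apply/diff_unique => //; exact: cst_continuous.
by rewrite dk; split => //; exact: cst_continuous.
Unshelve. all: by end_near. Qed.

Lemma near_in V (A : set V) (P : V -> Prop) x :
  open A -> A x -> (forall y, A y -> P y) -> \forall y \near x, P y.
Proof. by move=> oA Ax AP; apply: filterS AP _; exact: open_nbhs_nbhs. Qed.

Lemma Ck_ext V W k (A : set V) (f h : V -> W) : open A ->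
  (forall x, A x -> f x = h x) -> Ck k A f -> Ck k A h.
Proof.
move=> oA; elim: k f h => [|k IH] f h fh /=.
  move=> cf x Ax; suff : h @ x --> h x by [].
  rewrite -(fh _ Ax).
  apply: cvg_trans (cf x Ax); apply: near_eq_cvg.
  by apply: (near_in oA Ax) => y Ay; rewrite fh.
move=> [df Df]; split=> [x Ax|v].
  apply: near_eq_differentiable (df x Ax).
  by apply: (near_in oA Ax) => y Ay; rewrite fh.
apply: IH (Df v) => x Ax; apply: near_eq_derive.
by apply: (near_in oA Ax) => y Ay; rewrite fh.
Qed.

Lemma CkW V W k (A : set V) (f : V -> W) : Ck k.+1 A f -> Ck k A f.
Proof.
elim: k f => [|k IH] f [df Df] /=.
  by move=> x Ax; apply: differentiable_continuous; exact: df.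
by split=> // v; exact: IH (Df v).
Qed.

Lemma Ck_restrict V W k (A B : set V) (f : V -> W) :
  B `<=` A -> Ck k A f -> Ck k B f.
Proof.
move=> BA; elim: k f => [|k IH] f /=; first by move=> cf x /BA; exact: cf.
by move=> [df Df]; split=> [x /BA|v]; [exact: df | exact: IH].
Qed.

Lemma Ck_cst V W k (A : set V) (w : W) : Ck k A (fun=> w : W).
Proof.
elim: k w => [|k IH] w /=; first by move=> x _; exact: cst_continuous.
split=> [x _|v]; first exact: differentiable_cst.
have -> : (fun x => 'D_v (fun=> w) x) = fun=> 0 by apply/funext => x; exact: derive_cst.
exact: IH.
Qed.

Lemma Ck_add V W k (A : set V) (f h : V -> W) : open A ->
  Ck k A f -> Ck k A h -> Ck k A (fun x => f x + h x).
Proof.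
move=> oA; elim: k f h => [|k IH] f h /=.
  by move=> cf ch x Ax; apply: cvgD; [exact: cf | exact: ch].
move=> [df Df] [dh Dh]; split=> [x Ax|v].
  by apply: differentiableD; [exact: df | exact: dh].
apply: Ck_ext oA _ (IH _ _ (Df v) (Dh v)) => x Ax.
by rewrite -[RHS]/('D_v (f + h) x) deriveD //; apply: diff_derivable; [exact: df | exact: dh].
Qed.

Lemma Ck_mul V k (A : set V) (f h : V -> R^o) : open A ->
  Ck k A f -> Ck k A h -> Ck k A (fun x => f x * h x : R^o).
Proof.
move=> oA; elim: k f h => [|k IH] f h.
  by move=> cf ch x Ax; apply: cvgM; [exact: cf | exact: ch].
move=> sf sh; have [df Df] := sf; have [dh Dh] := sh.
split=> [x Ax|v].
  by apply: differentiableM; [exact: df | exact: dh].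
apply: (Ck_ext oA _ (Ck_add oA (IH _ _ (CkW sf) (Dh v)) (IH _ _ (CkW sh) (Df v)))) => x Ax.
by rewrite -[RHS]/('D_v (f * h) x) deriveM //; apply: diff_derivable; [exact: df | exact: dh].
Qed.

Lemma derive_scale_vector V W (f : V -> R^o) (w : W) x v : differentiable f x ->
  'D_v (fun y => f y *: w) x = 'D_v f x *: w.
Proof.
by move=> df; rewrite !deriveE ?diffZl //; exact: differentiableZl.
Qed.

Lemma Ck_scale_vector V W k (A : set V) (f : V -> R^o) (w : W) : open A ->
  Ck k A f -> Ck k A (fun x => f x *: w).
Proof.
move=> oA; elim: k f => [|k IH] f /=.
  by move=> cf x Ax; apply: cvgZr_tmp; exact: cf.
move=> [df Df]; split=> [x Ax|v]; first by apply: differentiableZl; exact: df.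
by apply: Ck_ext oA _ (IH _ (Df v)) => x Ax; rewrite derive_scale_vector //; exact: df.
Qed.

Lemma Ck_sum V W k (A : set V) (I : finType) (f : I -> V -> W) : open A ->
  (forall i, Ck k A (f i)) -> Ck k A (fun x => \sum_i f i x).
Proof.
move=> oA sf.
rewrite (_ : (fun x => _) = fun x => \sum_(i <- enum I) f i x); last first.
  by apply/funext => x; rewrite big_enum.
elim: (enum I) => [|i s IH].
  by apply: Ck_ext oA _ (Ck_cst _ _ (0 : W)) => x _; rewrite big_nil.
by apply: Ck_ext oA _ (Ck_add oA (sf i) IH) => x _; rewrite big_cons.
Qed.

Lemma diff_coord V m n (f : V -> 'M[R]_(m, n)) i j x v : differentiable f x ->
  differentiable (fun y => f y i j : R^o) x /\
  'D_v (fun y => f y i j : R^o) x = 'D_v f x i j.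
Proof.
move=> df; split.
  exact: (differentiable_comp df (differentiable_coord _ i j)).
by rewrite derive_mx ?mxE //; exact: diff_derivable.
Qed.

Lemma Ck_coord V m n k (A : set V) (f : V -> 'M[R]_(m, n)) i j : open A ->
  Ck k A f -> Ck k A (fun x => f x i j : R^o).
Proof.
move=> oA; elim: k f => [|k IH] f /=.
  move=> cf x Ax.
  apply: (@continuous_comp _ _ _ f (fun M : 'M[R]_(m, n) => M i j)).
    exact: cf.
  exact: coord_continuous.
move=> [df Df]; split=> [x Ax|v]; first by have [] := diff_coord i j 0 (df x Ax).
by apply: Ck_ext oA _ (IH _ (Df v)) => x Ax; have [_ ->] := diff_coord i j v (df x Ax).
Qed.

Lemma cV_sum m (w : 'cV[R]_m) : w = \sum_i w i 0 *: delta_mx i 0.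
Proof.
apply/colP => i; rewrite summxE (bigD1 i) //= !mxE !eqxx mulr1.
rewrite big1 ?addr0 // => j ji; rewrite !mxE eq_sym (negPf ji) mulr0 //.
Qed.

Lemma Ck_col V m k (A : set V) (f : V -> 'cV[R]_m) : open A ->
  (forall i, Ck k A (fun x => f x i 0 : R^o)) -> Ck k A f.
Proof.
move=> oA sf.
apply: (Ck_ext oA _ (Ck_sum oA (fun i => Ck_scale_vector (delta_mx i 0 : 'cV[R]_m) oA (sf i)))).
by move=> x _ /=; rewrite -cV_sum.
Qed.

Lemma derive_compose U V W (f : U -> V) (h : V -> W) x v :
  differentiable f x -> differentiable h (f x) ->
  'D_v (h \o f) x = 'D_('D_v f x) h (f x).
Proof.
move=> df dh.
by rewrite (deriveE v (differentiable_comp df dh)) (diff_comp df dh) (deriveE v df)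
  (deriveE _ dh).
Qed.

Lemma derive_linear V W (f : V -> W) x a v w : differentiable f x ->
  'D_(a *: v + w) f x = a *: 'D_v f x + 'D_w f x.
Proof. by move=> df; rewrite !(deriveE _ df) linearP. Qed.

Lemma derive_basis m W (f : 'cV[R]_m -> W) x w : differentiable f x ->
  'D_w f x = \sum_i w i 0 *: 'D_(delta_mx i 0) f x.
Proof.
move=> df; rewrite (deriveE _ df) {1}[w]cV_sum linear_sum.
by apply: eq_bigr => i _; rewrite linearZ (deriveE _ df).
Qed.

End CkTheory.

Section CkComposition.
Context {R : realType}.
Implicit Types U V W : normedModType R.

(** Induction on k: the derivative of the composite is a sum of products of
    components of the derivative of f with partial derivatives of h composed
    with f. *)
Lemma Ck_comp V m k (A : set V) (B : set 'cV[R]_m) (f : V -> 'cV[R]_m)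
    (h : 'cV[R]_m -> R^o) : open A -> (forall x, A x -> B (f x)) ->
  Ck k A f -> Ck k B h -> Ck k A (h \o f).
Proof.
move=> oA AB; elim: k h => [|k IH] h.
  by move=> cf ch x Ax; apply: continuous_comp; [exact: cf | exact: ch (AB _ Ax)].
move=> sf [dh Dh]; have [df Df] := sf.
split=> [x Ax|v]; first by apply: differentiable_comp; [exact: df | exact: dh (AB _ Ax)].
pose t i x : R^o := 'D_v f x i 0 * 'D_(delta_mx i 0) h (f x).
apply: (Ck_ext oA _ (@Ck_sum _ _ _ k A _ t oA _)).
  move=> x Ax; rewrite (derive_compose _ (df x Ax) (dh _ (AB _ Ax))).
  by rewrite (derive_basis _ (dh _ (AB _ Ax))).
move=> i; apply: Ck_mul => //; first exact: Ck_coord (Df v).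
exact: (IH _ (CkW sf) (Dh _)).
Qed.

Lemma Ck_comp_col V m n k (A : set V) (B : set 'cV[R]_m) (f : V -> 'cV[R]_m)
    (h : 'cV[R]_m -> 'cV[R]_n) : open A -> open B -> (forall x, A x -> B (f x)) ->
  Ck k A f -> Ck k B h -> Ck k A (h \o f).
Proof.
move=> oA oB AB sf sh; apply: Ck_col => // i.
exact: (Ck_comp oA AB sf (Ck_coord i 0 oB sh)).
Qed.

(** The derivative of r = f^(-1/2) is -1/2 r^3 times that of f, so that the order of
    differentiability of r climbs to that of f. *)
Lemma Ck_rsqrt V k (A : set V) (f : V -> R^o) : open A ->
  (forall x, A x -> 0 < f x) -> Ck k A f ->
  Ck k A (fun x => (Num.sqrt (f x))^-1 : R^o).
Proof.
move=> oA f0.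
pose r : R -> R := fun y => (Num.sqrt y)^-1.
have dr (y : R) : 0 < y -> is_derive (y : R^o) 1 (r : R^o -> R^o) (- 2^-1 * r y ^+ 3).
  move=> y0; have s0 : Num.sqrt y != 0 by rewrite gt_eqF // sqrtr_gt0.
  have [d1 e1] := is_derive1_sqrt y0.
  apply: DeriveDef; first exact: (derivableV s0 d1).
  by rewrite (deriveV s0 d1) e1 /r /GRing.scale /=; field.
have dR (y : R) : 0 < y -> differentiable (r : R^o -> R^o) (y : R^o).
  by move=> y0; apply/derivable1_diffP; have [] := dr y y0.
elim: k => [|k IH] sf.
  move=> x Ax; apply: (@continuous_comp _ _ _ f r); first exact: sf.
  exact/differentiable_continuous/dR/f0.
have [df Df] := sf.
split=> [x Ax|v].
  exact: (differentiable_comp (df x Ax) (dR _ (f0 _ Ax))).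
have sr := IH (CkW sf).
pose q x : R^o := r (f x).
have sq : Ck k A (fun x => - 2^-1 * (q x * (q x * q x)) * 'D_v f x : R^o).
  apply: (Ck_mul oA _ (Df v)); apply: (Ck_mul oA (Ck_cst _ _ _)).
  exact: (Ck_mul oA sr (Ck_mul oA sr sr)).
apply: (@Ck_ext _ V R^o k A _ _ oA _ sq).
move=> x Ax /=.
rewrite -[RHS]/('D_v (r \o f) x) (derive_compose _ (df x Ax) (dR _ (f0 _ Ax))).
have [_ e] := dr _ (f0 _ Ax).
have := @derive_linear _ R^o R^o r (f x) ('D_v f x) 1 0 (dR _ (f0 _ Ax)).
rewrite addr0 [_ *: 1]mulr1 e derive0 addr0 => ->.
by rewrite /GRing.scale /= /q; ring.
Qed.

Lemma derive_line V W (f : V -> W) x v (s : R) : differentiable f (x + s *: v) ->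
  is_derive s 1 (fun s : R => f (x + s *: v)) ('D_v f (x + s *: v)).
Proof.
move=> df.
have dl : differentiable (fun s : R^o => x + s *: v) s.
  by apply: differentiableD => //; exact: differentiableZl.
have -> : (fun s : R => f (x + s *: v)) = f \o (fun s : R^o => x + s *: v) by [].
apply: DeriveDef; first by apply: diff_derivable; exact: differentiable_comp.
rewrite derive_compose //; congr ('D__ _ _).
rewrite -[LHS]/('D_1 (cst x + (fun s : R^o => s *: v)) s) deriveD //; last first.
  by apply: diff_derivable; exact: differentiableZl.
by rewrite derive_cst add0r derive_scale_vector // derive_id scale1r.
Qed.

Lemma mean_value_line V (f : V -> R^o) x v (h : R) : 0 < h ->
  (forall s, 0 <= s <= h -> differentiable f (x + s *: v)) ->
  exists2 c, 0 < c < h & f (x + h *: v) - f x = 'D_v f (x + c *: v) * h.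
Proof.
move=> h0 df.
have [c| |c] := @MVT R (fun s => f (x + s *: v)) (fun s => 'D_v f (x + s *: v)) 0 h h0.
- rewrite in_itv /= => /andP[c0 ch]; apply: derive_line; apply: df.
  by rewrite !ltW.
- apply: derivable_within_continuous => c; rewrite in_itv /= => ch.
  by have [] := derive_line (df c ch).
- by rewrite in_itv /= scale0r addr0 subr0 => ch e; exists c.
Qed.

(** Two applications of the mean value theorem, first along v, then along w. *)
Lemma second_difference V (A : set V) (f : V -> R^o) x v w (h : R) :
  0 < h -> Ck 2 A f ->
  (forall s t, 0 <= s <= h -> 0 <= t <= h -> A (x + s *: v + t *: w)) ->
  exists c d, [/\ 0 < c < h, 0 < d < h &
    f (x + h *: v + h *: w) - f (x + h *: v) - (f (x + h *: w) - f x) =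
    'D_w (fun y => 'D_v f y) (x + c *: v + d *: w) * h * h].
Proof.
move=> h0 [df Df] Axh; have [dDf _] := Df v.
have h00 : 0 <= (0 : R) <= h by rewrite lexx ltW.
have hh : 0 <= h <= h by rewrite lexx ltW.
have A1 s : 0 <= s <= h -> A (x + s *: v).
  by move=> sh; have := Axh s 0 sh h00; rewrite scale0r addr0.
pose k : V -> R^o := (f \o shift (h *: w)) - f.
have dsh y : differentiable (shift (h *: w)) (y : V) by exact: differentiableD.
have dk s : 0 <= s <= h -> differentiable k (x + s *: v).
  move=> sh; apply: differentiableB; last exact/df/A1.
  apply: differentiable_comp; [exact: dsh | exact/df/Axh].
have [c /andP[c0 ch] ec] := mean_value_line h0 dk.
have ch' : 0 <= c <= h by rewrite !ltW.
have dfw s : 0 <= s <= h -> differentiable (fun y => 'D_v f y) (x + c *: v + s *: w).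
  by move=> sh; exact/dDf/Axh.
have [d dh ed] := mean_value_line h0 dfw.
exists c, d; split; rewrite ?c0 //.
rewrite -ed -[LHS]/(k (x + h *: v) - (f (x + h *: w) - f x)).
have -> : f (x + h *: w) - f x = k x by [].
rewrite ec; congr (_ * _).
rewrite /k deriveB; last 2 first.
- apply: diff_derivable; apply: differentiable_comp; [exact: dsh | exact/df/Axh].
- exact/diff_derivable/df/A1.
congr (_ - _); rewrite derive_compose; [|exact: dsh|exact/df/Axh].
congr ('D__ _ _).
rewrite -[LHS]/('D_v (id + cst (h *: w)) (x + c *: v)) deriveD //.
by rewrite derive_id derive_cst addr0.
Qed.

Lemma eq_of_close (a b : R^o) :
  (forall e : R, 0 < e -> exists z, `|a - z| < e /\ `|b - z| < e) -> a = b.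
Proof.
move=> close; apply/eqP; rewrite -subr_eq0 -normr_le0; apply/ler_addgt0Pl => e e0.
have [z [az bz]] := close (e / 2) (divr_gt0 e0 (ltr0Sn _ 1)).
rewrite addr0 (splitr e) -(subrKA z).
by apply: le_trans (ler_normD _ _) _; rewrite lerD // ltW // distrC.
Qed.

(** The second difference over a small parallelogram is symmetric in v and w, and is
    a value near x of either mixed derivative; both are continuous. *)
Theorem derive_symmetric V (A : set V) (f : V -> R^o) x v w : open A -> A x ->
  Ck 2 A f -> 'D_v (fun y => 'D_w f y) x = 'D_w (fun y => 'D_v f y) x.
Proof.
move=> oA Ax sf; have [_ Df] := sf.
have [_ Dv] := Df v; have [_ Dw] := Df w.
apply: eq_of_close => e2 e20.
have and3F (P1 P2 P3 : V -> Prop) : (\forall y \near x, P1 y) ->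
    (\forall y \near x, P2 y) -> (\forall y \near x, P3 y) ->
    \forall y \near x, [/\ P1 y, P2 y & P3 y].
  by move=> n1 n2 n3; apply: filterS3 n1 n2 n3.
have near1 : \forall y \near x,
    `|'D_v (fun y => 'D_w f y) x - 'D_v (fun y => 'D_w f y) y| < e2.
  by have /cvgrPdist_lt/(_ _ e20) := Dw v x Ax.
have near2 : \forall y \near x,
    `|'D_w (fun y => 'D_v f y) x - 'D_w (fun y => 'D_v f y) y| < e2.
  by have /cvgrPdist_lt/(_ _ e20) := Dv w x Ax.
have nearA : \forall y \near x, A y by exact: open_nbhs_nbhs.
have N : \forall y \near x, [/\ A y, `|'D_v (fun y => 'D_w f y) x - 'D_v (fun y => 'D_w f y) y| < e2
  & `|'D_w (fun y => 'D_v f y) x - 'D_w (fun y => 'D_v f y) y| < e2].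
  exact: and3F nearA near1 near2.
have [r /= r0 Hr] := (nbhs_ballP _ _).1 N.
pose h : R := r / 2 / (`|v| + `|w| + 1).
have n0 : 0 < `|v| + `|w| + 1 by rewrite ltr_wpDl // addr_ge0.
have h0 : 0 < h by rewrite !divr_gt0.
have inb s t : 0 <= s <= h -> 0 <= t <= h -> ball x r (x + s *: v + t *: w).
  move=> /andP[s0 sh] /andP[t0 th].
  rewrite -ball_normE /= -addrA opprD addrA subrr sub0r normrN.
  apply: le_lt_trans (ler_normD _ _) _; rewrite !normrZ !ger0_norm //.
  apply: (@le_lt_trans _ _ (h * (`|v| + `|w|))).
    by rewrite mulrDr lerD // ler_wpM2r.
  apply: (@le_lt_trans _ _ (h * (`|v| + `|w| + 1))).
    by rewrite ler_wpM2l ?(ltW h0) // lerDl.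
  by rewrite /h divfK ?gt_eqF // ltr_pdivrMr // ltr_pMr // ltr1n.
have [c [d [ch dh e1]]] := @second_difference V A f x v w h h0 sf
  (fun s t sh th => let: And3 a _ _ := Hr _ (inb s t sh th) in a).
have [c' [d' [ch' dh' e1']]] := @second_difference V A f x w v h h0 sf
  (fun s t sh th => let: And3 a _ _ := Hr _ (eq_ind _ _ (inb t s th sh) _ (addrAC _ _ _)) in a).
have swap (p q y z : R) : p - q - (y - z) = p - y - (q - z) by ring.
have E : 'D_w (fun y => 'D_v f y) (x + c *: v + d *: w) =
   'D_v (fun y => 'D_w f y) (x + c' *: w + d' *: v).
  apply: (mulIf (lt0r_neq0 h0)); apply: (mulIf (lt0r_neq0 h0)).
  apply: etrans (esym e1) (etrans _ e1'); rewrite (addrAC x (h *: v)).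
  exact: swap.
have lt_le s : 0 < s < h -> 0 <= s <= h by case/andP=> *; rewrite !ltW.
have [_ _ b1] := Hr _ (inb c d (lt_le _ ch) (lt_le _ dh)).
have [_ b2 _] := Hr _ (inb d' c' (lt_le _ dh') (lt_le _ ch')).
rewrite (addrAC x) -E in b2.
exists ('D_w (fun y => 'D_v f y) (x + c *: v + d *: w)); split; [exact: b2 | exact: b1].
Qed.
End CkComposition.

(** * Calculus in charts *)

Section ChartCalculus.
Context {R : realType} {N : nat} {M : topologicalType}.
Variable CM : complex_manifold R N M.
Local Notation vec := 'cV[R]_(N + N).
Implicit Types (c : chart R N M) (O : set M).

Definition chart_image c O : set vec := coord c @` (dom c `&` O).

Lemma paramK c q : atlas CM c -> dom c q -> param c (coord c q) = q.
Proof. by move=> /atlas_chart[_ _ _ _]; exact. Qed.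

Lemma open_chart_image c O : atlas CM c -> open O -> open (chart_image c O).
Proof.
move=> Ac oO; have [oc oi _ cp _] := atlas_chart Ac.
rewrite openE => x [q [cq Oq] qx].
have ix : (coord c @` dom c) x by exists q.
have n1 : \forall y \near x, (coord c @` dom c) y by exact: open_nbhs_nbhs.
have n2 : \forall y \near x, O (param c y).
  by apply: (cp x ix); apply: open_nbhs_nbhs; split; rewrite // -qx paramK.
apply: filterS2 n1 n2 => y [r cr <-] Or; exists r => //; split => //.
by rewrite -(paramK Ac cr).
Qed.

Lemma chart_image_coord c O q : dom c q -> O q -> chart_image c O (coord c q).
Proof. by move=> cq Oq; exists q. Qed.

Lemma transition_smooth c c' : atlas CM c -> atlas CM c' ->
  smooth (chart_image c (dom c')) (coord c' \o param c).
Proof. by move=> Ac Ac'; have [[]] := atlas_compatible Ac Ac'. Qed.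

Lemma transition_differentiable c c' q : atlas CM c -> atlas CM c' ->
  dom c q -> dom c' q -> differentiable (coord c' \o param c) (coord c q).
Proof.
move=> Ac Ac' cq cq'; have [d _] := transition_smooth Ac Ac' 1%N.
by apply: d; exact: chart_image_coord.
Qed.

Lemma near_chart c O q (P : vec -> Prop) : atlas CM c -> open O -> dom c q -> O q ->
  (forall r, dom c r -> O r -> P (coord c r)) -> \forall x \near coord c q, P x.
Proof.
move=> Ac oO cq Oq H.
apply: (near_in (open_chart_image Ac oO) (chart_image_coord cq Oq)).
by move=> y [r [cr Or] <-]; exact: H.
Qed.

Lemma dom_open c : atlas CM c -> open (dom c).
Proof. by case/atlas_chart. Qed.

(** The chain rule for a change of chart. Tangent vectors at q are components in the
    distinguished chart at q, which varies with q; this lemma moves every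
    computation to one fixed chart. *)
Lemma derive_chart (W : normedModType R) (f : M -> W) c c' q v :
  atlas CM c -> atlas CM c' -> dom c q -> dom c' q ->
  differentiable (f \o param c') (coord c' q) ->
  'D_v (f \o param c) (coord c q) =
  'D_('D_v (coord c' \o param c) (coord c q)) (f \o param c') (coord c' q).
Proof.
move=> Ac Ac' cq cq' df.
have e : (coord c' \o param c) (coord c q) = coord c' q by rewrite /= paramK.
rewrite -[in RHS]e -derive_compose; last 2 first.
- exact: transition_differentiable.
- by rewrite e.
apply: near_eq_derive; apply: (near_chart Ac (dom_open Ac') cq cq') => r cr cr'.
by rewrite /= !paramK.
Qed.

Let atp q : atlas CM (chart_at CM q) := atlas_chart_at CM q.
Let dat q : dom (chart_at CM q) q := dom_chart_at CM q.

Lemma derive_coord_param c q v : atlas CM c -> dom c q ->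
  'D_v (coord c \o param c) (coord c q) = v.
Proof.
move=> Ac cq; rewrite -[RHS](derive_id (coord c q) v).
apply: near_eq_derive; apply: (near_chart Ac (dom_open Ac) cq cq) => r cr _ /=.
by rewrite paramK.
Qed.

Lemma ddirE (f : M -> R) c q v : atlas CM c -> dom c q ->
  differentiable ((f : M -> R^o) \o param c) (coord c q) ->
  ddir CM f q v = 'D_(tcoord CM c q v) ((f : M -> R^o) \o param c) (coord c q).
Proof. by move=> Ac cq df; exact: derive_chart. Qed.

Lemma tcoord_of c c' q w : atlas CM c -> atlas CM c' -> dom c q -> dom c' q ->
  tcoord CM c' q (of_tcoord CM c q w) = 'D_w (coord c' \o param c) (coord c q).
Proof.
move=> Ac Ac' cq cq'; rewrite /tcoord /of_tcoord -derive_chart //.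
exact: transition_differentiable.
Qed.

Lemma tcoordK c q : atlas CM c -> dom c q ->
  cancel (tcoord CM c q) (of_tcoord CM c q).
Proof.
move=> Ac cq v; rewrite /tcoord /of_tcoord -derive_chart //.
  exact: derive_coord_param.
exact: transition_differentiable.
Qed.

Lemma tcoord_lin c q a v w : atlas CM c -> dom c q ->
  tcoord CM c q (a *: v + w) = a *: tcoord CM c q v + tcoord CM c q w.
Proof.
move=> Ac cq; apply: derive_linear; exact: transition_differentiable.
Qed.

Lemma tcoord_chart_at q v : tcoord CM (chart_at CM q) q v = v.
Proof. exact: derive_coord_param. Qed.

Local Notation sfun O f := (smooth_fun CM O (f : M -> R^o)).

Lemma smooth_fun_ext (W : normedModType R) O (f h : M -> W) : open O ->
  (forall p, O p -> f p = h p) ->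
  smooth_fun CM O f -> smooth_fun CM O h.
Proof.
move=> oO fh sf c Ac k; apply: Ck_ext (sf c Ac k); first exact: open_chart_image.
by move=> x [r [cr Or] <-] /=; rewrite (paramK Ac cr) // fh.
Qed.

Lemma smooth_fun_restrict (W : normedModType R) O O' (f : M -> W) : O' `<=` O ->
  smooth_fun CM O f -> smooth_fun CM O' f.
Proof.
move=> OO sf c Ac k; apply: Ck_restrict (sf c Ac k).
by move=> x [r [cr Or] <-]; exists r => //; split => //; exact: OO.
Qed.

Lemma smooth_fun_cst O (a : R) : sfun O (fun=> a).
Proof. by move=> c Ac k; exact: (@Ck_cst _ _ R^o). Qed.

Lemma smooth_fun_add O (f h : M -> R) : open O -> sfun O f -> sfun O h ->
  sfun O (fun p => f p + h p).
Proof.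
move=> oO sf sh c Ac k.
exact: (@Ck_add _ _ R^o _ _ _ _ (open_chart_image Ac oO) (sf c Ac k) (sh c Ac k)).
Qed.

Lemma smooth_fun_mul O (f h : M -> R) : open O -> sfun O f -> sfun O h ->
  sfun O (fun p => f p * h p).
Proof.
move=> oO sf sh c Ac k.
exact: (@Ck_mul _ _ _ _ _ _ (open_chart_image Ac oO) (sf c Ac k) (sh c Ac k)).
Qed.

Lemma smooth_fun_rsqrt O (f : M -> R) : open O -> (forall p, O p -> 0 < f p) ->
  sfun O f -> sfun O (fun p => (Num.sqrt (f p))^-1).
Proof.
move=> oO f0 sf c Ac k.
apply: (Ck_rsqrt (open_chart_image Ac oO) _ (sf c Ac k)).
by move=> x [r [cr Or] <-] /=; rewrite (paramK Ac cr) //; exact: f0.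
Qed.

Lemma smooth_fun_diff (f : M -> R) O c q : sfun O f -> O q -> atlas CM c ->
  dom c q -> differentiable ((f : M -> R^o) \o param c) (coord c q).
Proof.
by move=> sf Oq Ac cq; have [d _] := sf c Ac 1%N; apply: d; exact: chart_image_coord.
Qed.

Lemma smooth_fun_continuous (f : M -> R) O p : open O -> O p -> sfun O f ->
  {for p, continuous f}.
Proof.
move=> oO Op sf; set c := chart_at CM p.
have [oc _ cc _ _] := atlas_chart (atp p).
have c1 : {for coord c p, continuous ((f : M -> R^o) \o param c)}.
  exact: differentiable_continuous (smooth_fun_diff sf Op (atp p) (dat p)).
have : {for p, continuous (((f : M -> R^o) \o param c) \o coord c)}.
  by apply: continuous_comp => //; exact: cc (dat p).
move=> c2; suff : f @ p --> f p by [].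
have e : f p = (((f : M -> R^o) \o param c) \o coord c) p by rewrite /= (paramK (atp p) (dat p)).
rewrite e; apply: cvg_trans c2; apply: near_eq_cvg.
have oDc : \forall q \near p, dom c q.
  by apply: open_nbhs_nbhs; split; [exact: oc | exact: dat].
by apply: filterS oDc => q cq /=; rewrite (paramK (atp p) cq).
Qed.

Local Notation vf O X := (smooth_vf CM O X).
Implicit Types X Y : M -> vec.

Lemma smooth_vf_ext O X Y : open O -> (forall p, O p -> X p = Y p) ->
  vf O X -> vf O Y.
Proof.
move=> oO XY sX c Ac k; apply: Ck_ext (sX c Ac k); first exact: open_chart_image.
by move=> x [r [cr Or] <-]; rewrite /rep (paramK Ac cr) XY.
Qed.

Lemma smooth_vf_restrict O O' X : O' `<=` O -> vf O X -> vf O' X.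
Proof.
move=> OO sf c Ac k; apply: Ck_restrict (sf c Ac k).
by move=> x [r [cr Or] <-]; exists r => //; split => //; exact: OO.
Qed.

Lemma smooth_vf_add O X Y : open O -> vf O X -> vf O Y ->
  vf O (fun p => X p + Y p).
Proof.
move=> oO sX sY c Ac k.
have oI := open_chart_image Ac oO.
apply: (Ck_ext oI _ (Ck_add oI (sX c Ac k) (sY c Ac k))).
move=> x [r [cr Or] <-]; rewrite /rep (paramK Ac cr) //.
by rewrite -(scale1r (X r)) (tcoord_lin 1 _ _ Ac cr) !scale1r.
Qed.

Lemma smooth_vf_scale O (f : M -> R) X : open O -> sfun O f -> vf O X ->
  vf O (fun p => f p *: X p).
Proof.
move=> oO sf sX c Ac k.
have oI := open_chart_image Ac oO.
apply: Ck_col => // i.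
apply: (Ck_ext oI _ (Ck_mul oI (sf c Ac k) (Ck_coord i 0 oI (sX c Ac k)))).
move=> x [r [cr Or] <-] /=; rewrite /rep (paramK Ac cr) //.
have t0 : tcoord CM c r 0 = 0 by rewrite /tcoord derive0.
by rewrite -[f r *: X r]addr0 (tcoord_lin _ _ _ Ac cr) t0 addr0 mxE.
Qed.

Lemma smooth_vf0 O : open O -> vf O (fun=> 0).
Proof.
move=> oO c Ac k.
apply: (Ck_ext (open_chart_image Ac oO) _ (Ck_cst _ _ (0 : vec))).
by move=> x _; rewrite /rep /tcoord derive0.
Qed.

Lemma smooth_vf_of_tcoord c w : atlas CM c -> vf (dom c) (fun q => of_tcoord CM c q w).
Proof.
move=> Ac c' Ac' k.
have oI := open_chart_image Ac' (dom_open Ac).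
have oB := open_chart_image Ac (dom_open Ac').
pose h := fun y => 'D_w (coord c' \o param c) y.
have sh : Ck k (chart_image c (dom c')) h.
  by have [_ D] := transition_smooth Ac Ac' k.+1; exact: D.
apply: (Ck_ext oI _ (Ck_comp_col oI oB _ (transition_smooth Ac' Ac k) sh)).
  by move=> x [r [cr Or] <-]; rewrite /h /= /rep (paramK Ac' cr) tcoord_of.
by move=> x [r [cr Or] <-] /=; rewrite (paramK Ac' cr); exists r.
Qed.

Lemma smooth_coord c i : atlas CM c -> sfun (dom c) (fun q => coord c q i 0).
Proof.
move=> Ac c' Ac' k; have oI := open_chart_image Ac' (dom_open Ac).
exact: (Ck_coord i 0 oI (transition_smooth Ac' Ac k)).
Qed.

Lemma ddir_coord c i q v : atlas CM c -> dom c q ->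
  ddir CM (fun q => coord c q i 0) q v = tcoord CM c q v i 0.
Proof.
move=> Ac cq; rewrite (ddirE _ Ac cq); last first.
  by have [] := diff_coord i 0 0 (transition_differentiable Ac Ac cq cq).
have [_ e] := diff_coord i 0 (tcoord CM c q v) (transition_differentiable Ac Ac cq cq).
by rewrite -[LHS]/('D__ (fun y => (coord c \o param c) y i 0) _) e derive_coord_param.
Qed.

(** Differentiate the coordinates of a chart. *)
Lemma ddir_faithful c q v : atlas CM c -> dom c q ->
  (forall i, ddir CM (fun q => coord c q i 0) q v = 0) -> v = 0.
Proof.
move=> Ac cq e; have /(congr1 (of_tcoord CM c q)) : tcoord CM c q v = tcoord CM c q 0.
  apply/colP => i; rewrite -(ddir_coord _ _ Ac cq) e.
  by rewrite [tcoord CM c q 0]derive0 mxE.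
by rewrite !(tcoordK Ac cq).
Qed.

Lemma ddir_ext O (f h : M -> R) p v : open O -> O p -> (forall q, O q -> f q = h q) ->
  ddir CM f p v = ddir CM h p v.
Proof.
move=> oO Op fh; apply: near_eq_derive.
by apply: (near_chart (atp p) oO (dat p) Op) => r cr Or /=; rewrite paramK // fh.
Qed.

Lemma ddir_linear O (f : M -> R) p a v w : open O -> O p -> sfun O f ->
  ddir CM f p (a *: v + w) = a * ddir CM f p v + ddir CM f p w.
Proof.
move=> oO Op sf; exact: (derive_linear _ _ _ (smooth_fun_diff sf Op (atp p) (dat p))).
Qed.

Lemma ddirD O (f h : M -> R) p v : open O -> O p -> sfun O f -> sfun O h ->
  ddir CM (fun q => f q + h q) p v = ddir CM f p v + ddir CM h p v.
Proof.
move=> oO Op sf sh.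
have df := smooth_fun_diff sf Op (atp p) (dat p).
have dh := smooth_fun_diff sh Op (atp p) (dat p).
have := deriveD (diff_derivable (v:=v) df) (diff_derivable (v:=v) dh).
by rewrite /ddir; move=> <-; congr ('D_v _ _); apply/funext.
Qed.

Lemma ddirM O (f h : M -> R) p v : open O -> O p -> sfun O f -> sfun O h ->
  ddir CM (fun q => f q * h q) p v = ddir CM f p v * h p + f p * ddir CM h p v.
Proof.
move=> oO Op sf sh.
have df := smooth_fun_diff sf Op (atp p) (dat p).
have dh := smooth_fun_diff sh Op (atp p) (dat p).
have := deriveM (diff_derivable (v:=v) df) (diff_derivable (v:=v) dh).
rewrite /GRing.scale /= (paramK (atp p) (dat p)) => e.
by rewrite addrC (mulrC (ddir _ _ _ _)); exact: e.
Qed.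

(** Read in one chart, both sides differ by second derivatives of f contracted with
    X and Y in the two orders, which agree by [derive_symmetric]. *)
Lemma ddir_bracket O (f : M -> R) X Y p : open O -> O p -> sfun O f ->
  vf O X -> vf O Y ->
  ddir CM f p (bracket CM X Y p) =
  ddir CM (fun q => ddir CM f q (Y q)) p (X p) -
  ddir CM (fun q => ddir CM f q (X q)) p (Y p).
Proof.
move=> oO Op sf sX sY; set c := chart_at CM p.
have Ac : atlas CM c := atp p.
have cp : dom c p := dat p.
set h : vec -> R^o := f \o param c.
have oI := open_chart_image Ac oO.
have Ip := chart_image_coord cp Op.
have sh k : Ck k (chart_image c O) h := sf c Ac k.
pose e i : vec := delta_mx i 0.
have key X' Y' : vf O X' -> vf O Y' ->
   ddir CM (fun q => ddir CM f q (Y' q)) p (X' p) =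
   'D_('D_(X' p) (rep CM c Y') (coord c p)) h (coord c p) +
   \sum_i rep CM c Y' (coord c p) i 0 *
     'D_(X' p) (fun x => 'D_(e i) h x) (coord c p).
  move=> sX' sY'.
  have dY' : differentiable (rep CM c Y') (coord c p).
    by have [d _] := sY' c Ac 1%N; exact: d.
  have [dh Dh] := sh 2.
  transitivity ('D_(X' p) (\sum_i (fun x => rep CM c Y' x i 0 * 'D_(e i) h x : R^o)) (coord c p)).
    apply: near_eq_derive; apply: (near_in oI Ip) => x [r [cr Or] <-].
    rewrite fct_sumE /= paramK // (ddirE _ Ac cr); last exact: (smooth_fun_diff sf Or).
    rewrite derive_basis; last by apply: dh; exists r.
    by rewrite /rep paramK.
  have dc i := diff_coord i 0 (X' p) dY'.
  have dD i : differentiable (fun x => 'D_(e i) h x) (coord c p).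
    by have [d _] := Dh (e i); exact: d.
  rewrite derive_sum; last first.
    by move=> i; apply: derivableM; apply: diff_derivable; [exact: (dc i).1 | exact: dD].
  rewrite [in RHS](derive_basis _ (dh _ Ip)) -big_split; apply: eq_bigr => i _ /=.
  have := deriveM (diff_derivable (v:=X' p) (dc i).1) (diff_derivable (v:=X' p) (dD i)).
  rewrite (dc i).2 => e1; apply: (etrans e1).
  by rewrite addrC /GRing.scale /=; congr (_ + _); exact: mulrC.
rewrite !key // /ddir /bracket -/c -/h.
have [dh Dh] := sh 2.
rewrite -scaleN1r addrC (derive_linear _ _ _ (dh _ Ip)) scaleN1r.
have repp X' : rep CM c X' (coord c p) = X' p.
  by rewrite /rep paramK // tcoord_chart_at.
rewrite !repp.
(* The second order terms of [key], as iterated derivatives along v and w. *)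
have Dsum (v w : vec) : \sum_i v i 0 * 'D_w (fun x => 'D_(e i) h x) (coord c p) =
   'D_v (fun x => 'D_w h x) (coord c p).
  have [dw _] := Dh w.
  rewrite [RHS](derive_basis _ (dw _ Ip)); apply: eq_bigr => i _.
  by rewrite (derive_symmetric _ _ oI Ip (sh 2)).
have S12 := etrans (Dsum (Y p) (X p))
  (etrans (derive_symmetric (Y p) (X p) oI Ip (sh 2)) (esym (Dsum (X p) (Y p)))).
have cancel_sum (a b s s' : R^o) : s = s' -> - b + a = a + s - (b + s').
  by move=> <-; rewrite opprD addrACA subrr addr0 addrC.
apply: cancel_sum.
exact: S12.
Qed.

End ChartCalculus.

(** * Orthonormal frames *)

Section BilinearForms.
Context {R : realType} {m : nat}.
Implicit Types (B : 'M[R]_m) (x y z : 'cV[R]_m).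

Lemma bilDl B x y z : bil B (x + y) z = bil B x z + bil B y z.
Proof. by rewrite /bil linearD /= !mulmxDl mxE. Qed.
Lemma bilZl B a x y : bil B (a *: x) y = a * bil B x y.
Proof. by rewrite /bil linearZ /= -!scalemxAl mxE. Qed.
Lemma bilDr B x y z : bil B z (x + y) = bil B z x + bil B z y.
Proof. by rewrite /bil mulmxDr mxE. Qed.
Lemma bilZr B a x y : bil B y (a *: x) = a * bil B y x.
Proof. by rewrite /bil -scalemxAr mxE. Qed.
Lemma bil0l B y : bil B 0 y = 0.
Proof. by rewrite -(scale0r (0 : 'cV_m)) bilZl mul0r. Qed.
Lemma bil0r B y : bil B y 0 = 0.
Proof. by rewrite -(scale0r (0 : 'cV_m)) bilZr mul0r. Qed.
Lemma bilNl B x y : bil B (- x) y = - bil B x y.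
Proof. by rewrite -scaleN1r bilZl mulN1r. Qed.
Lemma bilNr B x y : bil B y (- x) = - bil B y x.
Proof. by rewrite -scaleN1r bilZr mulN1r. Qed.
Definition bilE := (bilDl, bilDr, bilNl, bilNr, bilZl, bilZr, bil0l, bil0r).
Lemma bil_suml B (I : finType) (F : I -> 'cV[R]_m) y :
  bil B (\sum_i F i) y = \sum_i bil B (F i) y.
Proof. exact: (big_morph (fun x => bil B x y) (fun a b => bilDl B a b y) (bil0l B y)). Qed.

Lemma orthonormal_expand B (e : 'I_m -> 'cV[R]_m) x :
  (forall x y, bil B x y = bil B y x) ->
  (forall a b, bil B (e a) (e b) = (a == b)%:R) ->
  x = \sum_a bil B x (e a) *: e a.
Proof.
move=> Bs oe; pose P : 'M[R]_m := \matrix_(i, a) e a i 0.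
have colE a : col a P = e a by apply/colP => i; rewrite !mxE.
have PBP : P^T *m B *m P = 1%:M.
  apply/matrixP => a b; rewrite [RHS]mxE -oe /bil -!colE tr_col -row_mul.
  by rewrite [LHS]mxE [RHS]mxE; apply: eq_bigr => j _; rewrite !mxE.
have := mulmx1C PBP; rewrite mulmxA => e1.
rewrite -[LHS]mul1mx -e1 -!mulmxA.
rewrite [LHS](_ : _ = P *m (\col_a bil B x (e a))); last first.
  congr (_ *m _); apply/colP => a; rewrite [RHS]mxE Bs /bil -colE tr_col -!row_mul mulmxA.
  by rewrite [RHS]mxE.
apply/colP => i; rewrite mxE summxE; apply: eq_bigr => a _.
by rewrite !mxE mulrC.
Qed.

Lemma orthogonal_exists B k (e : 'I_k -> 'cV[R]_m) : (k < m)%N ->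
  exists2 w : 'cV[R]_m, w != 0 & forall a, bil B w (e a) = 0.
Proof.
move=> km; pose P : 'M[R]_(m, k) := \matrix_(i, a) (B *m e a) i 0.
have : kermx P != 0.
  rewrite kermx_eq0 /row_free neq_ltn; apply/orP; left.
  exact: leq_ltn_trans (rank_leq_col P) km.
case/rowV0Pn => v /sub_kermxP vP v0; exists v^T.
  by rewrite -(inj_eq trmx_inj) trmxK trmx0.
move=> a; rewrite /bil trmxK -mulmxA.
transitivity ((v *m P) 0 a); last by rewrite vP mxE.
by rewrite !mxE; apply: eq_bigr => j _; rewrite !mxE.
Qed.

End BilinearForms.

Section Frames.
Context {R : realType} {N : nat} {M : topologicalType}.
Variable CM : complex_manifold R N M.
Variable g : M -> 'M[R]_(N + N).
Hypothesis hg : riemannian_metric CM g.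
Local Notation vec := 'cV[R]_(N + N).

Lemma smooth_vf_sum O (I : finType) (X : I -> M -> vec) : open O ->
  (forall i, smooth_vf CM O (X i)) -> smooth_vf CM O (fun q => \sum_i X i q).
Proof.
move=> oO sX.
rewrite (_ : (fun q => _) = fun q => \sum_(i <- enum I) X i q); last first.
  by apply/funext => q; rewrite big_enum.
elim: (enum I) => [|i s IH].
  by apply: (smooth_vf_ext oO _ (smooth_vf0 oO)) => q _; rewrite big_nil.
by apply: (smooth_vf_ext oO _ (smooth_vf_add oO (sX i) IH)) => q _; rewrite big_cons.
Qed.

Lemma smooth_metric O (X Y : M -> vec) : open O -> smooth_vf CM O X -> smooth_vf CM O Y ->
  smooth_fun CM O (fun q => bil (g q) (X q) (Y q) : R^o).
Proof. by move=> oO sX sY; exact: (metric_smooth hg oO (@subsetT _ O) sX sY). Qed.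

Lemma smooth_vf_subtract O (X Y : M -> vec) : open O -> smooth_vf CM O X -> smooth_vf CM O Y ->
  smooth_vf CM O (fun q => X q - Y q).
Proof.
move=> oO sX sY.
apply: (smooth_vf_ext oO _ (smooth_vf_add oO sX
  (smooth_vf_scale oO (@smooth_fun_cst _ _ _ CM O (-1)) sY))).
by move=> q _; rewrite scaleN1r.
Qed.

(** At p some vector is orthogonal to the first k fields. Extend it with constant
    components in a chart, subtract the projections, and normalise where the
    square of the length is still positive. *)
Lemma gram_schmidt O p k : open O -> O p -> (k <= N + N)%N ->
  exists O' (E : nat -> M -> vec),
    [/\ open O', O' p, O' `<=` O,
      forall a, (a < k)%N -> smooth_vf CM O' (E a) &
      forall q a b, O' q -> (a < k)%N -> (b < k)%N ->
        bil (g q) (E a q) (E b q) = (a == b)%:R].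
Proof.
move=> oO Op; elim: k => [_|k IH km].
  by exists O, (fun _ _ => 0); split.
have [B1 [E [oO1 O1p B1O sE oE]]] := IH (ltnW km).
have [w w0 wE] := orthogonal_exists (g p) (fun a : 'I_k => E a p) km.
set c := chart_at CM p.
have Ac : atlas CM c := atlas_chart_at CM p.
have cp : dom c p := dom_chart_at CM p.
(* The field with constant components through w in the chart at p. *)
pose W q := of_tcoord CM c q (tcoord CM c p w).
have Wp : W p = w by rewrite /W tcoordK.
pose B2 := B1 `&` dom c.
have oO2 : open B2 by apply: openI => //; exact: dom_open Ac.
have sE2 (a : 'I_k) : smooth_vf CM B2 (E a).
  by apply: (smooth_vf_restrict _ (sE a (ltn_ord a))); exact: subIsetl.
have sW : smooth_vf CM B2 W.
  by apply: (smooth_vf_restrict _ (smooth_vf_of_tcoord _ Ac)); exact: subIsetr.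
pose Y q := W q - \sum_(a < k) bil (g q) (W q) (E a q) *: E a q.
have sY : smooth_vf CM B2 Y.
  apply: (smooth_vf_subtract oO2 sW); apply: (smooth_vf_sum oO2) => a.
  exact: (smooth_vf_scale oO2 (smooth_metric oO2 sW (sE2 a)) (sE2 a)).
pose f q := bil (g q) (Y q) (Y q).
have sf : smooth_fun CM B2 (f : M -> R^o) by exact: (smooth_metric oO2 sY sY).
pose B3 := B2 `&` [set q | 0 < f q].
have oO3 : open B3.
  rewrite openE => q [B2q fq].
  have n1 : \forall r \near q, B2 r by exact: open_nbhs_nbhs.
  have n2 : \forall r \near q, 0 < f r.
    have cf : f @ q --> f q := smooth_fun_continuous oO2 B2q sf.
    move/cvgrPdist_lt: cf => /(_ _ fq); apply: filterS => r.
    by move/(le_lt_trans (ler_norm _)); rewrite ltrBlDr ltrDl.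
  by apply: filterS2 n1 n2 => r.
have O3p : B3 p.
  split=> //; rewrite /= /f.
  have -> : Y p = w.
    by rewrite /Y Wp big1 ?subr0 // => a _; rewrite wE scale0r.
  exact: (metric_pos hg).
have YE q (a : 'I_k) : B1 q -> bil (g q) (Y q) (E a q) = 0.
  move=> B1q; rewrite /Y !bilE bil_suml (bigD1 a) //= big1 ?addr0.
    by rewrite bilE oE // eqxx mulr1 subrr.
  by move=> b ba; rewrite bilE oE // -(inj_eq val_inj) in ba *; rewrite (negPf ba) mulr0.
pose F q := (Num.sqrt (f q))^-1 *: Y q.
have sF : smooth_vf CM B3 F.
  have B3B2 : B3 `<=` B2 by exact: subIsetl.
  apply: (smooth_vf_scale oO3 _ (smooth_vf_restrict B3B2 sY)).
  by apply: (smooth_fun_rsqrt oO3 _ (smooth_fun_restrict B3B2 sf)) => q [].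
exists B3, (fun a => if a == k then F else E a); split.
- exact: oO3.
- exact: O3p.
- by move=> q [[/B1O]].
- move=> a; rewrite ltnS leq_eqVlt; case: (eqVneq a k) => [_ _|_ /= ak].
    exact: sF.
  by apply: (smooth_vf_restrict _ (sE a ak)) => q [[]].
move=> q a b [[B1q cq] fq].
have FE (a' : 'I_k) : bil (g q) (F q) (E a' q) = 0.
  by rewrite /F bilZl YE // mulr0.
have FF : bil (g q) (F q) (F q) = 1.
  rewrite /F bilZl bilZr -/(f q) mulrA -invfM -expr2 sqr_sqrtr ?mulVf ?gt_eqF //.
  exact: ltW.
rewrite !ltnS (leq_eqVlt a) (leq_eqVlt b).
case: (eqVneq a k) => [->|ak] /=; case: (eqVneq b k) => [->|bk] /=.
- by rewrite FF.
- by move=> _ bk'; rewrite (FE (Ordinal bk')).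
- by move=> ak' _; rewrite (metric_sym hg) (FE (Ordinal ak')) (negPf ak).
- by move=> ak' bk'; rewrite oE.
Qed.

Lemma frame_exists O p : open O -> O p ->
  exists O' E, [/\ open O', O' p, O' `<=` O & orthonormal_frame CM g O' E].
Proof.
move=> oO Op; have [B [E [oB Bp BO sE oE]]] := gram_schmidt oO Op (leqnn (N + N)).
exists B, (fun a => E a); split=> //; split=> [a|q a b Bq].
  exact: (sE a (ltn_ord a)).
exact: (oE q a b Bq (ltn_ord a) (ltn_ord b)).
Qed.
End Frames.

(** * The module of vector fields on an open set *)

(** Openness is packed with the set because the ring and module structures below
    depend on it. *)
Record open_set (M : topologicalType) := OpenSet {
  carrier : set M;
  open_setP : open carrier }.

Section SmoothAlgebra.
Context {R : realType} {N : nat} {M : topologicalType}.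
Variable CM : complex_manifold R N M.
Variable U : open_set M.
Local Notation vec := 'cV[R]_(N + N).
Local Notation pts := {q : M | carrier U q}.

(** Functions on the subset carry the algebra, so that equality is equality on the
    open set; extension by zero turns them into the globally defined functions
    that the differential operators act on. *)
Definition ext0 (W : zmodType) (f : pts -> W) (q : M) : W :=
  if pselect (carrier U q) is left Uq then f (exist _ q Uq) else 0.

Lemma ext0_val (W : zmodType) (f : pts -> W) (t : pts) : ext0 f (sval t) = f t.
Proof.
case: t => q Uq; rewrite /ext0 /=; case: pselect => // Uq'.
by congr (f (exist _ _ _)); exact: Prop_irrelevance.
Qed.

Lemma ext0_restrict (W : zmodType) (f : M -> W) q : carrier U q ->
  ext0 (fun t : pts => f (sval t)) q = f q.
Proof. by move=> Uq; rewrite -[q]/(sval (exist _ q Uq)) ext0_val. Qed.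

Definition sfun_pred : {pred (pts -> R)} :=
  fun f => `[< smooth_fun CM (carrier U) (ext0 f : M -> R^o) >].
Definition svf_pred : {pred (pts -> vec)} :=
  fun X => `[< smooth_vf CM (carrier U) (ext0 X) >].

Let oU : open (carrier U) := open_setP U.

Lemma sfun_subring : subring_closed sfun_pred.
Proof.
split.
- apply/asboolP; apply: (smooth_fun_ext oU _ (@smooth_fun_cst _ _ _ CM (carrier U) 1)).
  by move=> q Uq; rewrite (ext0_restrict (fun=> 1)).
- move=> f h /asboolP sf /asboolP sh; apply/asboolP.
  apply: (smooth_fun_ext oU _ (smooth_fun_add oU sf
    (smooth_fun_mul oU (@smooth_fun_cst _ _ _ CM (carrier U) (-1)) sh))) => q Uq.
  by rewrite -[q]/(sval (exist _ q Uq)) !ext0_val mulN1r.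
- move=> f h /asboolP sf /asboolP sh; apply/asboolP.
  apply: (smooth_fun_ext oU _ (smooth_fun_mul oU sf sh)) => q Uq.
  by rewrite -[q]/(sval (exist _ q Uq)) !ext0_val.
Qed.

Lemma svf_zmod : zmod_closed svf_pred.
Proof.
split.
- apply/asboolP; apply: (smooth_vf_ext oU _ (smooth_vf0 oU)) => q Uq.
  by rewrite (ext0_restrict (fun=> 0)).
- move=> X Y /asboolP sX /asboolP sY; apply/asboolP.
  apply: (smooth_vf_ext oU _ (smooth_vf_subtract oU sX sY)) => q Uq.
  by rewrite -[q]/(sval (exist _ q Uq)) !ext0_val.
Qed.

HB.instance Definition _ := GRing.isZmodClosed.Build _ svf_pred svf_zmod.

Record sfun := SFun { sfun_val : pts -> R; sfunP : sfun_val \in sfun_pred }.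
HB.instance Definition _ := [isSub for sfun_val].
HB.instance Definition _ := [Choice of sfun by <:].
HB.instance Definition _ := GRing.SubChoice_isSubComPzRing.Build _ _ sfun sfun_subring.

Record svf := SVf { svf_val : pts -> vec; svfP : svf_val \in svf_pred }.
HB.instance Definition _ := [isSub for svf_val].
HB.instance Definition _ := [Choice of svf by <:].
HB.instance Definition _ := [SubChoice_isSubZmodule of svf by <:].

Lemma scale_svf_subproof (f : sfun) (X : svf) :
  (fun t => sfun_val f t *: svf_val X t) \in svf_pred.
Proof.
case: f X => f /= /asboolP sf [X /= /asboolP sX]; apply/asboolP.
apply: (smooth_vf_ext oU _ (smooth_vf_scale oU sf sX)) => q Uq.
by rewrite -[q]/(sval (exist _ q Uq)) !ext0_val.
Qed.
Definition scale_svf f X := SVf (scale_svf_subproof f X).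

Lemma svf_eq (X Y : svf) : (forall t, svf_val X t = svf_val Y t) -> X = Y.
Proof. by move=> e; apply/val_inj/funext => t; exact: e. Qed.
Lemma sfun_eq (f h : sfun) : (forall t, sfun_val f t = sfun_val h t) -> f = h.
Proof. by move=> e; apply/val_inj/funext => t; exact: e. Qed.

Lemma scale_svfA f h X : scale_svf f (scale_svf h X) = scale_svf (f * h) X.
Proof. by apply: svf_eq => t; rewrite /= scalerA. Qed.
Lemma scale_svf1 : left_id 1 scale_svf.
Proof. by move=> X; apply: svf_eq => t; rewrite /= scale1r. Qed.
Lemma scale_svfDr : right_distributive scale_svf +%R.
Proof. by move=> f X Y; apply: svf_eq => t; rewrite /= scalerDr. Qed.
Lemma scale_svfDl X : {morph scale_svf^~ X : f h / f + h}.
Proof. by move=> f h; apply: svf_eq => t; rewrite /= scalerDl. Qed.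
HB.instance Definition _ := GRing.Zmodule_isLmodule.Build sfun svf
  scale_svfA scale_svf1 scale_svfDr scale_svfDl.

Definition fn (f : sfun) : M -> R := ext0 (sfun_val f).
Definition fld (X : svf) : M -> vec := ext0 (svf_val X).

Lemma fn_smooth f : smooth_fun CM (carrier U) (fn f : M -> R^o).
Proof. exact: asboolW (sfunP f). Qed.
Lemma fld_smooth X : smooth_vf CM (carrier U) (fld X).
Proof. exact: asboolW (svfP X). Qed.

Lemma mkfun_subproof (f : M -> R) :
  smooth_fun CM (carrier U) (f : M -> R^o) -> (fun t : pts => f (sval t)) \in sfun_pred.
Proof.
move=> sf; apply/asboolP; apply: (smooth_fun_ext oU _ sf) => q Uq.
by rewrite (ext0_restrict f).
Qed.
Definition mkfun f sf := SFun (@mkfun_subproof f sf).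
Lemma mkfld_subproof (X : M -> vec) :
  smooth_vf CM (carrier U) X -> (fun t : pts => X (sval t)) \in svf_pred.
Proof.
move=> sf; apply/asboolP; apply: (smooth_vf_ext oU _ sf) => q Uq.
by rewrite (ext0_restrict X).
Qed.
Definition mkfld X sX := SVf (@mkfld_subproof X sX).

Lemma fn_mk f sf q : carrier U q -> fn (@mkfun f sf) q = f q.
Proof. exact: (ext0_restrict f). Qed.
Lemma fld_mk X sX q : carrier U q -> fld (@mkfld X sX) q = X q.
Proof. exact: (ext0_restrict X). Qed.

Lemma fnP f h : (forall q, carrier U q -> fn f q = fn h q) -> f = h.
Proof.
by move=> e; apply: sfun_eq => t; rewrite -!ext0_val; exact/e/svalP.
Qed.
Lemma fldP X Y : (forall q, carrier U q -> fld X q = fld Y q) -> X = Y.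
Proof.
by move=> e; apply: svf_eq => t; rewrite -!ext0_val; exact/e/svalP.
Qed.

Lemma fnD f h : fn (f + h) = fun q => fn f q + fn h q.
Proof. by apply/funext => q; rewrite /fn /ext0; case: pselect => //= _; rewrite addr0. Qed.
Lemma fnN f : fn (- f) = fun q => - fn f q.
Proof. by apply/funext => q; rewrite /fn /ext0; case: pselect => //= _; rewrite oppr0. Qed.
Lemma fnM f h : fn (f * h) = fun q => fn f q * fn h q.
Proof. by apply/funext => q; rewrite /fn /ext0; case: pselect => //= _; rewrite mulr0. Qed.
Lemma fn1 q : carrier U q -> fn 1 q = 1.
Proof. by move=> Uq; rewrite -[q]/(sval (exist _ q Uq)) /fn ext0_val. Qed.
Lemma fn0 q : fn 0 q = 0.
Proof. by rewrite /fn /ext0; case: pselect. Qed.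
Lemma fldD X Y : fld (X + Y) = fun q => fld X q + fld Y q.
Proof. by apply/funext => q; rewrite /fld /ext0; case: pselect => //= _; rewrite addr0. Qed.
Lemma fldN X : fld (- X) = fun q => - fld X q.
Proof. by apply/funext => q; rewrite /fld /ext0; case: pselect => //= _; rewrite oppr0. Qed.
Lemma fldZ f X : fld (f *: X) = fun q => fn f q *: fld X q.
Proof. by apply/funext => q; rewrite /fld /fn /ext0; case: pselect => //= _; rewrite scaler0. Qed.
Lemma fld0 q : fld 0 q = 0.
Proof. by rewrite /fld /ext0; case: pselect. Qed.

End SmoothAlgebra.

(** * The Levi-Civita connection as a connection algebra *)

Section LeviCivitaOfMetric.
Context {R : realType} {N : nat} {M : topologicalType}.
Variable CM : complex_manifold R N M.
Variable U : open_set M.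
Variable g : M -> 'M[R]_(N + N).
Variable nabla : (M -> 'cV[R]_(N + N)) -> (M -> 'cV[R]_(N + N)) -> (M -> 'cV[R]_(N + N)).
Hypothesis hg : riemannian_metric CM g.
Hypothesis hn : levi_civita CM g nabla.
Local Notation vec := 'cV[R]_(N + N).
Local Notation A := (sfun CM U).
Local Notation V := (svf CM U).
Local Notation O := (carrier U).
Let oU : open O := open_setP U.

Variable E0 : V.
Hypothesis E0_unit : forall q, O q -> bil (g q) (fld E0 q) (fld E0 q) = 1.
Variable c : chart R N M.
Hypothesis Ac : atlas CM c.
Hypothesis Uc : O `<=` dom c.

Definition metricA (X Y : V) : A :=
  locked (mkfun (smooth_metric hg oU (fld_smooth X) (fld_smooth Y))).
Definition nablaA (X Y : V) : V :=
  locked (mkfld (nabla_smooth hn oU (fld_smooth X) (fld_smooth Y))).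

Lemma metricAE X Y q : O q -> fn (metricA X Y) q = bil (g q) (fld X q) (fld Y q).
Proof. by move=> Uq; rewrite /metricA -lock fn_mk. Qed.

Lemma nablaAE X Y q : O q -> fld (nablaA X Y) q = nabla (fld X) (fld Y) q.
Proof. by move=> Uq; rewrite /nablaA -lock fld_mk. Qed.

(** The Leibniz rule recovers the derivative of f from the connection: it is the
    component along a unit field E0 of nabla_X (f E0) - f nabla_X E0. *)
Lemma ddir_smooth (f : A) (X : V) :
  smooth_fun CM O ((fun q => ddir CM (fn f) q (fld X q)) : M -> R^o).
Proof.
apply: (smooth_fun_ext oU _ (fn_smooth (metricA (nablaA X (f *: E0) - f *: nablaA X E0) E0))).
move=> q Uq; rewrite (metricAE _ _ Uq) fldD fldN fldZ !(nablaAE _ _ Uq) fldZ.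
rewrite (nabla_leibniz hn oU Uq (fn_smooth f) (fld_smooth X) (fld_smooth E0)).
by rewrite addrK bilZl (E0_unit Uq) mulr1.
Qed.

Definition ddirA (X : V) (f : A) : A := locked (mkfun (ddir_smooth f X)).

Lemma ddirAE X f q : O q -> fn (ddirA X f) q = ddir CM (fn f) q (fld X q).
Proof. by move=> Uq; rewrite /ddirA -lock fn_mk. Qed.

(** The hypothesis that the open set lies in a chart is for [lca_faithful], which
    needs coordinate functions. *)
Lemma levi_civita_sections : levi_civita_algebra metricA ddirA nablaA.
Proof.
split.
- move=> a a0; apply: fnP => q Uq; have := congr1 (fun f => fn f q) a0.
  rewrite mulr2n fnD !fn0 => /eqP.
  by rewrite -mulr2n mulrn_eq0 /= => /eqP.
- by move=> X Y; apply: fnP => q Uq; rewrite !(metricAE _ _ Uq); exact: (metric_sym hg).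
- by move=> X Y Z; apply: fnP => q Uq; rewrite fnD !(metricAE _ _ Uq) fldD bilDl.
- by move=> a X Y; apply: fnP => q Uq; rewrite fnM !(metricAE _ _ Uq) fldZ bilZl.
- move=> X X0; apply: fldP => q Uq; rewrite fld0.
  have := congr1 (fun f => fn f q) (X0 X); rewrite (metricAE _ _ Uq) fn0 => e.
  apply/eqP; apply/negPn/negP => nz.
  by have := metric_pos hg q nz; rewrite e ltxx.
- move=> X a b; apply: fnP => q Uq; rewrite fnD !(ddirAE _ _ Uq) fnD.
  exact: (ddirD _ oU Uq (fn_smooth a) (fn_smooth b)).
- move=> X a b; apply: fnP => q Uq; rewrite fnD !fnM !(ddirAE _ _ Uq) fnM.
  exact: (ddirM _ oU Uq (fn_smooth a) (fn_smooth b)).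
- move=> X DX0; apply: fldP => q Uq; rewrite fld0.
  apply: (ddir_faithful Ac (Uc Uq)) => i.
  have sci := smooth_fun_restrict Uc (smooth_coord i Ac).
  have := congr1 (fun f => fn f q) (DX0 (mkfun sci)); rewrite (ddirAE _ _ Uq) fn0 => e.
  apply: (etrans _ e); apply: (ddir_ext CM _ oU Uq) => r Ur.
  by rewrite fn_mk.
- move=> X Y a; apply: fnP => q Uq; rewrite fnD !(ddirAE _ _ Uq) fldD.
  have := ddir_linear 1 (fld X q) (fld Y q) oU Uq (fn_smooth a).
  by rewrite scale1r mul1r.
- move=> a X b; apply: fnP => q Uq; rewrite fnM !(ddirAE _ _ Uq) fldZ.
  have := ddir_linear (fn a q) (fld X q) 0 oU Uq (fn_smooth b).
  by rewrite addr0 => ->; rewrite [ddir _ _ _ 0]derive0 addr0.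
- move=> X X' Y; apply: fldP => q Uq; rewrite fldD !(nablaAE _ _ Uq) fldD.
  exact: (nabla_addl hn oU Uq (fld_smooth X) (fld_smooth X') (fld_smooth Y)).
- move=> a X Y; apply: fldP => q Uq; rewrite fldZ !(nablaAE _ _ Uq) fldZ.
  exact: (nabla_scalel hn oU Uq (fn_smooth a) (fld_smooth X) (fld_smooth Y)).
- move=> X Y Y'; apply: fldP => q Uq; rewrite fldD !(nablaAE _ _ Uq) fldD.
  exact: (nabla_addr hn oU Uq (fld_smooth X) (fld_smooth Y) (fld_smooth Y')).
- move=> a X Y; apply: fldP => q Uq; rewrite fldD !fldZ (ddirAE _ _ Uq) !(nablaAE _ _ Uq) fldZ.
  exact: (nabla_leibniz hn oU Uq (fn_smooth a) (fld_smooth X) (fld_smooth Y)).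
- move=> X Y Z; apply: fnP => q Uq; rewrite fnD (ddirAE _ _ Uq).
  rewrite !(metricAE _ _ Uq) !(nablaAE _ _ Uq).
  rewrite -(nabla_metric hn oU Uq (fld_smooth X) (fld_smooth Y) (fld_smooth Z)).
  by apply: (ddir_ext CM _ oU Uq) => r Ur; rewrite (metricAE _ _ Ur).
- move=> X Y a; apply: fnP => q Uq; rewrite fnD fnN !(ddirAE _ _ Uq) fldD fldN !(nablaAE _ _ Uq).
  rewrite (nabla_torsion_free hn oU Uq (fld_smooth X) (fld_smooth Y)).
  rewrite (ddir_bracket oU Uq (fn_smooth a) (fld_smooth X) (fld_smooth Y)).
  by congr (_ - _); apply: (ddir_ext CM _ oU Uq) => r Ur; rewrite (ddirAE _ _ Ur).
Qed.

(** Values of nabla at a point depend on the fields on the open set only. *)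
Lemma nabla_ext X X' Y Y' q : O q ->
  smooth_vf CM O X -> smooth_vf CM O X' -> smooth_vf CM O Y -> smooth_vf CM O Y' ->
  (forall r, O r -> X r = X' r) -> (forall r, O r -> Y r = Y' r) ->
  nabla X Y q = nabla X' Y' q.
Proof.
move=> Uq sX sX' sY sY' XX YY.
apply: (nabla_local hn oU sX sX' sY sY'); last exact: mem_set.
  by move=> r /set_mem; exact: XX.
by move=> r /set_mem; exact: YY.
Qed.

Lemma curvAE X Y Z q : O q ->
  fld (curv nablaA X Y Z) q = curvature CM nabla (fld X) (fld Y) (fld Z) q.
Proof.
move=> Uq; have s := @fld_smooth _ _ _ CM U.
have nE X' Y' r : O r -> fld (nablaA X' Y') r = nabla (fld X') (fld Y') r := @nablaAE X' Y' r.
have sn X' Y' := nabla_smooth hn oU (s X') (s Y').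
have br r : O r -> fld (lie nablaA X Y) r = bracket CM (fld X) (fld Y) r.
  move=> Ur; rewrite lieE fldD fldN !(nE _ _ _ Ur).
  exact: (nabla_torsion_free hn oU Ur (s X) (s Y)).
rewrite curvE !fldD !fldN !(nE _ _ _ Uq) /curvature; congr (_ - _ - _).
- exact: (nabla_ext Uq (s X) (s X) (s _) (sn Y Z) (fun r _ => erefl) (nE Y Z)).
- exact: (nabla_ext Uq (s Y) (s Y) (s _) (sn X Z) (fun r _ => erefl) (nE X Z)).
exact: (nabla_ext Uq (s _) (smooth_vf_ext oU br (s _)) (s Z) (s Z) br (fun r _ => erefl)).
Qed.

End LeviCivitaOfMetric.

(** * The contact pair of the structure tensors *)

Section PointwiseAlgebra.
Local Open Scope complex_scope.
Context {R : realType}.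

Lemma outer_ev m (a : 'rV[R]_m) (x y : 'cV[R]_m) : (y *m a) *m x = ev a x *: y.
Proof. by rewrite -mulmxA [a *m x]mx11_scalar mul_mx_scalar. Qed.

Lemma JmxK N : @Jmx R N *m Jmx = - 1%:M.
Proof.
rewrite /Jmx mulmx_block !mul0mx !mulmx0 !mulmx1 !mul1mx !add0r !addr0.
by rewrite scalar_mx_block opp_block_mx !oppr0.
Qed.

(** A complex combination u - iv vanishes on a real vector when both u and v do. *)
Lemma evC_split N (f : R[i]) (u v : 'rV[R]_(N + N)) x : f != 0 ->
  evC (f *: (map_mx (real_complex R) u - (0 +i* 1) *: map_mx (real_complex R) v)) x = 0
  <-> ev u x = 0 /\ ev v x = 0.
Proof.
move=> f0.
have evCZ a (w : 'rV[R[i]]_(N + N)) : evC (a *: w) x = a * evC w x.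
  by rewrite /evC -scalemxAl mxE.
have evCB (w w' : 'rV[R[i]]_(N + N)) : evC (w - w') x = evC w x - evC w' x.
  by rewrite /evC mulmxBl mxE [X in _ + X]mxE.
have evCR (w : 'rV[R]_(N + N)) : evC (map_mx (real_complex R) w) x = (ev w x)%:C.
  by rewrite /evC -map_mxM mxE.
rewrite evCZ evCB evCZ !evCR.
split=> [/eqP|[-> ->]]; last by rewrite !(mulr0, subrr).
rewrite mulf_eq0 (negPf f0) /= => /eqP.
move: (ev u x) (ev v x) => a b; rewrite /real_complex_def; simpc.
by case=> -> /eqP; rewrite oppr_eq0 => /eqP ->.
Qed.

End PointwiseAlgebra.

Section Endomorphisms.
Context {R : realType} {N : nat} {M : topologicalType}.
Variable CM : complex_manifold R N M.
Variable U : open_set M.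
Variable g : M -> 'M[R]_(N + N).
Variable nabla : (M -> 'cV[R]_(N + N)) -> (M -> 'cV[R]_(N + N)) -> (M -> 'cV[R]_(N + N)).
Hypothesis hn : levi_civita CM g nabla.
Local Notation V := (svf CM U).
Local Notation O := (carrier U).
Let oU : open O := open_setP U.
Variable T : M -> 'M[R]_(N + N).
Hypothesis sT : smooth_endo CM O T.

Definition endoA (X : V) : V :=
  locked (mkfld (sT oU (@subset_refl _ O) (fld_smooth X))).

Lemma endoAE X q : O q -> fld (endoA X) q = T q *m fld X q.
Proof. by move=> Uq; rewrite /endoA -lock fld_mk. Qed.

Lemma endoAD X Y : endoA (X + Y) = endoA X + endoA Y.
Proof. by apply: fldP => q Uq; rewrite fldD !endoAE // fldD mulmxDr. Qed.

Lemma endoAZ a X : endoA (a *: X) = a *: endoA X.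
Proof. by apply: fldP => q Uq; rewrite fldZ !endoAE // fldZ scalemxAr. Qed.

Lemma nijenhuisAE X Y q : O q ->
  fld (nijenhuis (nablaA hn) endoA X Y) q = torsion_endo nabla T (fld X) (fld Y) q.
Proof.
move=> Uq; have s := @fld_smooth _ _ _ CM U.
have sTa (Z : V) : smooth_vf CM O (tapply T (fld Z)).
  exact: (sT oU (@subset_refl _ O) (s Z)).
have covAE (X' : V) X1 (Y' : V) r : O r -> smooth_vf CM O X1 ->
    (forall r, O r -> fld X' r = X1 r) ->
    fld (cov (nablaA hn) endoA X' Y') r = cov_endo nabla T X1 (fld Y') r.
  move=> Ur sX1 eX; rewrite covE fldD fldN endoAE // !nablaAE // /cov_endo.
  have e1 : nabla (fld X') (fld (endoA Y')) r = nabla X1 (tapply T (fld Y')) r.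
    apply: (nabla_ext hn Ur (s _) sX1 (s _) (sTa Y') eX) => r' Ur'.
    exact: endoAE.
  by rewrite e1 (nabla_ext hn Ur (s X') sX1 (s Y') (s Y') eX (fun _ _ => erefl)).
rewrite nijenhuisE !fldD !fldN !endoAE // /torsion_endo.
rewrite (covAE _ (tapply T (fld X)) _ _ Uq (sTa X) (endoAE X)).
rewrite (covAE _ (tapply T (fld Y)) _ _ Uq (sTa Y) (endoAE Y)).
by rewrite (covAE X (fld X) _ _ Uq (s X)) // (covAE Y (fld Y) _ _ Uq (s Y)).
Qed.

End Endomorphisms.

Section ContactPairOfStructure.
Context {R : realType} {n : nat} {M : topologicalType}.
Local Notation N := (n.*2.+1).
Variable CM : complex_manifold R N M.
Variable g : M -> 'M[R]_(N + N).
Variable nabla : (M -> 'cV[R]_(N + N)) -> (M -> 'cV[R]_(N + N)) -> (M -> 'cV[R]_(N + N)).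
Variable K : @contact_structure R N M.
Variable S : @almost_contact_structure R N M.
Hypothesis hn : levi_civita CM g nabla.
Hypothesis hm : complex_contact_metric CM g nabla K S.
Hypothesis hN : normal_structure CM g nabla K S.
Variable i : ac_index S.
Variable U : open_set M.
Local Notation O := (carrier U).
Hypothesis OU : O `<=` ac_nbhd i.
Local Notation V := (svf CM U).
Local Notation L := (ac_tensors i).
Let oU : open O := open_setP U.
Let hac := ccm_almost_contact hm.
Let hg : riemannian_metric CM g := hermitian_riemannian (cac_hermitian hac).
Let hL : local_almost_contact_metric CM g (ac_nbhd i) L := cac_local hac i.

Lemma smooth_endo_sub (T : M -> 'M[R]_(N + N)) :
  smooth_endo CM (ac_nbhd i) T -> smooth_endo CM O T.
Proof. by move=> sT B X oB BO; apply: sT => //; exact: subset_trans BO OU. Qed.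

Definition xiA : V := locked (mkfld (smooth_vf_restrict OU (lac_smooth_U hL))).
Definition etaA : V := locked (mkfld (smooth_vf_restrict OU (lac_smooth_V hL))).
Definition GA : V -> V := endoA (smooth_endo_sub (lac_smooth_G hL)).
Definition HA : V -> V := endoA (smooth_endo_sub (lac_smooth_H hL)).
Local Notation gA := (metricA (CM := CM) (U := U) hg).
Local Notation nA := (nablaA (CM := CM) (U := U) hn).

Lemma xiAE q : O q -> fld xiA q = sU L q.
Proof. by move=> Uq; rewrite /xiA -lock fld_mk. Qed.
Lemma etaAE q : O q -> fld etaA q = sV L q.
Proof. by move=> Uq; rewrite /etaA -lock fld_mk. Qed.
Lemma GAE X q : O q -> fld (GA X) q = sG L q *m fld X q. Proof. exact: endoAE. Qed.
Lemma HAE X q : O q -> fld (HA X) q = sH L q *m fld X q. Proof. exact: endoAE. Qed.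

Lemma uE q x : O q -> ev (su L q) x = bil (g q) x (sU L q).
Proof. by move=> Uq; rewrite (lac_u_dual hL _ (OU Uq)); exact: (metric_sym hg). Qed.
Lemma vE q x : O q -> ev (sv L q) x = bil (g q) x (sV L q).
Proof. by move=> Uq; rewrite (lac_v_dual hL _ (OU Uq)); exact: (metric_sym hg). Qed.

Lemma xiA_unit q : O q -> bil (g q) (fld xiA q) (fld xiA q) = 1.
Proof. by move=> Uq; rewrite (xiAE Uq) -(uE _ Uq); exact: (lac_uU hL (OU Uq)). Qed.

Lemma connformAE X q : O q -> fn (connform gA nA xiA etaA X) q = sigma g nabla L (fld X) q.
Proof.
move=> Uq; rewrite connformE (metricAE _ _ _ Uq) (nablaAE _ _ _ Uq) (etaAE Uq) /sigma.
by rewrite (nabla_ext hn Uq (fld_smooth X) (fld_smooth X) (fld_smooth xiA)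
  (smooth_vf_restrict OU (lac_smooth_U hL)) (fun _ _ => erefl) xiAE).
Qed.

Lemma horizontalP X : horizontal K O X <->
  forall q, O q -> ev (su L q) (X q) = 0 /\ ev (sv L q) (X q) = 0.
Proof.
split=> hX.
  move=> q Uq; have [j jq] := cc_cover (ccm_contact hm) q.
  have [f /(_ q (conj (OU Uq) jq))[f0 fE]] := ccm_theta hm i j.
  by apply/(evC_split _ _ _ f0); rewrite -fE; exact: hX.
move=> j q Uq jq; have [f /(_ q (conj (OU Uq) jq))[f0 fE]] := ccm_theta hm i j.
by rewrite fE; apply/(evC_split _ _ _ f0); exact: hX.
Qed.

(** Locally theta is u - iv up to a non-vanishing factor, so that the horizontal
    distribution of the contact structure is the algebraic one. *)
Lemma horizontalAP X : is_horizontal gA xiA etaA X <-> horizontal K O (fld X).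
Proof.
split=> [[h1 h2]|/horizontalP h].
  apply/horizontalP => q Uq; rewrite (uE _ Uq) (vE _ Uq).
  have e1 : fn (gA X xiA) q = 0 by rewrite h1 fn0.
  have e2 : fn (gA X etaA) q = 0 by rewrite h2 fn0.
  rewrite (metricAE hg X xiA Uq) (xiAE Uq) in e1.
  by rewrite (metricAE hg X etaA Uq) (etaAE Uq) in e2.
split; apply: fnP => q Uq; rewrite fn0; have [h1 h2] := h q Uq.
  by rewrite (metricAE hg X xiA Uq) (xiAE Uq) -(uE _ Uq).
by rewrite (metricAE hg X etaA Uq) (etaAE Uq) -(vE _ Uq).
Qed.

(** The structure equations are stated with the exterior derivative; by torsion
    freeness and metric compatibility it is the skew part of nabla W. *)
Lemma ext_d_dual (w : M -> 'rV[R]_(N + N)) (W X Y : V) q : O q ->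
  (forall r x, O r -> ev (w r) x = bil (g r) x (fld W r)) ->
  ext_d CM w (fld X) (fld Y) q * 2 =
  bil (g q) (nabla (fld X) (fld W) q) (fld Y q) - bil (g q) (nabla (fld Y) (fld W) q) (fld X q).
Proof.
move=> Uq wW; have s := @fld_smooth _ _ _ CM U.
rewrite /ext_d mulrC mulVKf ?pnatr_eq0 //.
have wW_ := wW q (nabla (fld X) (fld Y) q - nabla (fld Y) (fld X) q) Uq.
rewrite -(nabla_torsion_free hn oU Uq (s X) (s Y)).
have dE (Z1 Z2 : V) : ddir CM (fun r => ev (w r) (fld Z2 r)) q (fld Z1 q) =
    bil (g q) (nabla (fld Z1) (fld Z2) q) (fld W q)
    + bil (g q) (fld Z2 q) (nabla (fld Z1) (fld W) q).
  rewrite -(nabla_metric hn oU Uq (s Z1) (s Z2) (s W)).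
  by apply: (ddir_ext CM _ oU Uq) => r Ur; rewrite wW.
rewrite !dE wW_ bilDl bilNl.

rewrite (metric_sym hg q (nabla (fld X) (fld W) q)) (metric_sym hg q (nabla (fld Y) (fld W) q)).
ring.
Qed.

Lemma GVp q : O q -> sG L q *m sV L q = 0.
Proof.
move=> Uq; rewrite (lac_VE hL (OU Uq)) mulmxN mulmxA (lac_GJ hL (OU Uq)).
by rewrite mulNmx -mulmxA (lac_GU hL (OU Uq)) mulmx0 !oppr0.
Qed.

Lemma JGp q : O q -> Jmx *m sG L q = - sH L q.
Proof. by move=> Uq; rewrite (lac_HE hL (OU Uq)) (lac_GJ hL (OU Uq)) opprK. Qed.

Lemma HVp q : O q -> sH L q *m sV L q = 0.
Proof.
move=> Uq; rewrite -[sH L q]opprK -(JGp Uq) mulNmx -mulmxA (GVp Uq) mulmx0 oppr0 //.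
Qed.

Lemma HUp q : O q -> sH L q *m sU L q = 0.
Proof.
move=> Uq; rewrite -[sH L q]opprK -(JGp Uq) mulNmx -mulmxA (lac_GU hL (OU Uq)) mulmx0 oppr0 //.
Qed.

Lemma HGp q : O q -> sH L q *m sG L q = - (sG L q *m sH L q).
Proof.
move=> Uq; rewrite {1}(lac_HE hL (OU Uq)) -mulmxA (JGp Uq) mulmxN //.
Qed.

Lemma H_skewp q x y : O q -> bil (g q) x (sH L q *m y) = - bil (g q) (sH L q *m x) y.
Proof.
move=> Uq; have Uiq := OU Uq.
rewrite {1}(lac_HE hL Uiq) -mulmxA (lac_G_skew hL _ _ Uiq); congr (- _).
rewrite -[sH L q]opprK -(JGp Uq) mulNmx bilNl -mulmxA.
rewrite -(hermitian_J (cac_hermitian hac) _ (Jmx *m _) y) mulmxA JmxK mulNmx mul1mx.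
by rewrite bilNl opprK.
Qed.

Lemma squarep q (T : 'M[R]_(N + N)) x : O q ->
  T *m T = - 1%:M + sU L q *m su L q + sV L q *m sv L q ->
  T *m (T *m x) = - x + bil (g q) x (sU L q) *: sU L q + bil (g q) x (sV L q) *: sV L q.
Proof.
move=> Uq TT; rewrite mulmxA TT !mulmxDl !outer_ev mulNmx mul1mx.
by rewrite (uE _ Uq) (vE _ Uq).
Qed.

Let LC : forall c, atlas CM c -> O `<=` dom c ->
    levi_civita_algebra gA (ddirA hg hn xiA_unit) nA :=
  fun c Ac Oc => levi_civita_sections hg hn xiA_unit Ac Oc.

(** The value at a point of the sum that makes up [normalS], for arbitrary
    summands: with the concrete fields in place, rewriting under [fld] would
    compare their bodies. *)
Lemma fld_normal_value (T x e a b c d : V) (s1 s2 s3 s4 s5 s6 s7 s8 : sfun CM U) q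
    vT vx ve va vb vc vd r1 r2 r3 r4 r5 r6 r7 r8 :
  fld T q = vT -> fld x q = vx -> fld e q = ve -> fld a q = va -> fld b q = vb ->
  fld c q = vc -> fld d q = vd ->
  fn s1 q = r1 -> fn s2 q = r2 -> fn s3 q = r3 -> fn s4 q = r4 ->
  fn s5 q = r5 -> fn s6 q = r6 -> fn s7 q = r7 -> fn s8 q = r8 ->
  fld (T + (s1 *+ 2) *: x - (s2 *+ 2) *: e + (s3 *: a - s4 *: b) *+ 2
       + s5 *: a - s6 *: b + s7 *: c - s8 *: d) q =
  vT + (2 * r1) *: vx - (2 * r2) *: ve + 2 *: (r3 *: va - r4 *: vb)
  + r5 *: va - r6 *: vb + r7 *: vc - r8 *: vd.
Proof.
do 15!move=> <-.
rewrite !mulr2n !fldD !fldN !fldZ !fnD.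
by rewrite [2 *: _]scaler_nat !mulr2n !mulrDl !mul1r.
Qed.

Lemma sigma_tapply (T : M -> 'M[R]_(N + N)) (TX X : V) q : O q -> smooth_endo CM O T ->
  (forall r, O r -> fld TX r = T r *m fld X r) ->
  fn (connform gA nA xiA etaA TX) q = sigma g nabla L (tapply T (fld X)) q.
Proof.
move=> Uq sT e; apply: (etrans (connformAE TX Uq)); rewrite /sigma.
have sU' := smooth_vf_restrict OU (lac_smooth_U hL).
by rewrite (nabla_ext hn Uq (fld_smooth TX) (sT _ _ oU (@subset_refl _ O) (fld_smooth X)) sU' sU' e
  (fun _ _ => erefl)).
Qed.

Let sGL := smooth_endo_sub (lac_smooth_G hL).
Let sHL := smooth_endo_sub (lac_smooth_H hL).

Lemma metric_GA X Y q : O q -> fn (gA X (GA Y)) q = bil (g q) (fld X q) (sG L q *m fld Y q).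
Proof. by move=> Uq; rewrite (metricAE hg X (GA Y) Uq) (GAE Y Uq). Qed.
Lemma metric_HA X Y q : O q -> fn (gA X (HA Y)) q = bil (g q) (fld X q) (sH L q *m fld Y q).
Proof. by move=> Uq; rewrite (metricAE hg X (HA Y) Uq) (HAE Y Uq). Qed.
Lemma metric_xi X q : O q -> fn (gA X xiA) q = ev (su L q) (fld X q).
Proof. by move=> Uq; rewrite (metricAE hg X xiA Uq) (xiAE Uq) (uE _ Uq). Qed.
Lemma metric_eta X q : O q -> fn (gA X etaA) q = ev (sv L q) (fld X q).
Proof. by move=> Uq; rewrite (metricAE hg X etaA Uq) (etaAE Uq) (vE _ Uq). Qed.
Lemma eta_metric X q : O q -> fn (gA etaA X) q = ev (sv L q) (fld X q).
Proof.
move=> Uq; rewrite (metricAE hg etaA X Uq) (etaAE Uq) (vE _ Uq); exact: (metric_sym hg).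
Qed.
Lemma xi_metric X q : O q -> fn (gA xiA X) q = ev (su L q) (fld X q).
Proof.
move=> Uq; rewrite (metricAE hg xiA X Uq) (xiAE Uq) (uE _ Uq); exact: (metric_sym hg).
Qed.

Lemma GHAE X q : O q -> fld (GA (HA X)) q = sG L q *m (sH L q *m fld X q).
Proof. by move=> Uq; rewrite (GAE (HA X) Uq) (HAE X Uq). Qed.

Lemma normalS_eval X Y q : O q ->
  fld (normalS gA nA xiA etaA GA HA X Y) q = tensorS g nabla L (fld X) (fld Y) q.
Proof.
move=> Uq; apply: fld_normal_value.
- exact: (nijenhuisAE hn sGL X Y Uq).
- exact: xiAE.
- exact: etaAE.
- exact: HAE.
- exact: HAE.
- exact: GHAE.
- exact: GHAE.
- exact: metric_GA.
- exact: metric_HA.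
- exact: eta_metric.
- exact: eta_metric.
- exact: (sigma_tapply Uq sGL (GAE Y)).
- exact: (sigma_tapply Uq sGL (GAE X)).
- exact: connformAE.
- exact: connformAE.
Qed.

Variable c : chart R N M.
Hypothesis Ac : atlas CM c.
Hypothesis Uc : O `<=` dom c.
Local Notation dA := (ddirA hg hn xiA_unit).
Let LCA : levi_civita_algebra gA dA nA := LC Ac Uc.

Lemma tensorT_rearrange (vT x e a b c1 d : 'cV[R]_(N + N)) (r1 r2 r3 r4 r5 r6 r7 r8 : R) :
  vT + (2 * r1) *: x - (2 * - r2) *: (- e) + 2 *: ((- r3) *: (- a) - (- r4) *: (- b))
  + r5 *: (- a) - r6 *: (- b) + r7 *: c1 - r8 *: d =
  vT - (2 * r2) *: e + (2 * r1) *: x + 2 *: (r3 *: a - r4 *: b)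
  + r6 *: b - r5 *: a + r7 *: c1 - r8 *: d.
Proof.
rewrite !scaleNr !scalerN !opprK mulrN scaleNr.
by rewrite (addrAC vT) (addrAC _ (- (r5 *: a))).
Qed.

Lemma normalT_eval X Y q : O q ->
  fld (normalS gA nA etaA (- xiA) HA (fun Z => - GA Z) X Y) q =
  tensorT g nabla L (fld X) (fld Y) q.
Proof.
move=> Uq.
have rot Z : connform gA nA etaA (- xiA) Z = connform gA nA xiA etaA Z.
  apply: (connform_rot LCA); apply: fnP => r Ur; rewrite fn0.
  by apply: (etrans (metric_eta xiA Ur)); rewrite (xiAE Ur) (lac_vU hL (OU Ur)).
have fN (Z : V) r z : O r -> fld Z r = z -> fld (- Z) r = - z.
  by move=> _ <-; rewrite fldN.
have gN (f : sfun CM U) r z : fn f r = z -> fn (- f) r = - z.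
  by move=> <-; rewrite fnN.
apply: (etrans _ (tensorT_rearrange _ _ _ _ _ _ _ _ _ _ _ _ _ _ _)).
apply: fld_normal_value.
- exact: (nijenhuisAE hn sHL X Y Uq).
- exact: etaAE.
- exact: (fN _ _ _ Uq (xiAE Uq)).
- exact: (fN _ _ _ Uq (GAE X Uq)).
- exact: (fN _ _ _ Uq (GAE Y Uq)).
- apply: (etrans (HAE (- GA Y) Uq)); rewrite fldN (GAE Y Uq) mulmxN (mulmxA (sH L q)) (HGp Uq).
  by rewrite mulNmx opprK -mulmxA.
- apply: (etrans (HAE (- GA X) Uq)); rewrite fldN (GAE X Uq) mulmxN (mulmxA (sH L q)) (HGp Uq).
  by rewrite mulNmx opprK -mulmxA.
- exact: metric_HA.
- apply: (etrans (congr1 (fun f => fn f q) (gNr LCA (GA Y) X))); apply: gN; exact: metric_GA.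
- apply: (etrans (congr1 (fun f => fn f q) (gNl LCA xiA Y))); apply: gN; exact: xi_metric.
- apply: (etrans (congr1 (fun f => fn f q) (gNl LCA xiA X))); apply: gN; exact: xi_metric.
- apply: (etrans (congr1 (fun f => fn f q) (rot _))); exact: (sigma_tapply Uq sHL (HAE Y)).
- apply: (etrans (congr1 (fun f => fn f q) (rot _))); exact: (sigma_tapply Uq sHL (HAE X)).
- apply: (etrans (congr1 (fun f => fn f q) (rot _))); exact: connformAE.
- apply: (etrans (congr1 (fun f => fn f q) (rot _))); exact: connformAE.
Qed.

Lemma fld_square_value (X x e : V) (s t : sfun CM U) q vx ve a b :
  fn s q = a -> fn t q = b -> fld x q = vx -> fld e q = ve ->
  fld (- X + s *: x + t *: e) q = - fld X q + a *: vx + b *: ve.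
Proof. by do 4!move=> <-; rewrite !fldD fldN !fldZ. Qed.

Lemma fldN_value (Z : V) q z : fld Z q = z -> fld (- Z) q = - z.
Proof. by move=> <-; rewrite fldN. Qed.

Lemma fn_du_value (s t1 t2 t3 t4 f1 f2 : sfun CM U) q a b c1 c2 c3 c4 d1 d2 e :
  fn f1 q = d1 -> fn f2 q = d2 -> fn s q = a ->
  fn t1 q = c1 -> fn t2 q = c2 -> fn t3 q = c3 -> fn t4 q = c4 ->
  b * 2 = d1 - d2 -> b = a + 2^-1 * e -> e = c1 * c2 - c3 * c4 ->
  fn (f1 - f2) q = fn (s *+ 2 + (t1 * t2 - t3 * t4)) q.
Proof.
move=> <- <- <- <- <- <- <- h1 h2 h3; rewrite mulr2n !fnD !fnN !fnM -h1 h2 h3.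
by field.
Qed.

Lemma fn_dv_value (s t1 t2 t3 t4 f1 f2 : sfun CM U) q a b c1 c2 c3 c4 d1 d2 e :
  fn f1 q = d1 -> fn f2 q = d2 -> fn s q = a ->
  fn t1 q = c1 -> fn t2 q = c2 -> fn t3 q = c3 -> fn t4 q = c4 ->
  b * 2 = d1 - d2 -> b = a - 2^-1 * e -> e = c1 * c2 - c3 * c4 ->
  fn (f1 - f2) q = fn (s *+ 2 - (t1 * t2 - t3 * t4)) q.
Proof.
move=> <- <- <- <- <- <- <- h1 h2 h3; rewrite mulr2n !fnD !fnN fnD !fnN !fnM -h1 h2 h3.
by field.
Qed.

Lemma nab_metric X Y (W : V) q : O q ->
  fn (gA (nA X W) Y) q = bil (g q) (nabla (fld X) (fld W) q) (fld Y q).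
Proof. by move=> Uq; rewrite (metricAE hg (nA X W) Y Uq) (nablaAE hn X W Uq). Qed.

Lemma cov_endo_ext (T : M -> 'M[R]_(N + N)) X X' Y Y' q : O q -> smooth_endo CM O T ->
  smooth_vf CM O X -> smooth_vf CM O X' -> smooth_vf CM O Y -> smooth_vf CM O Y' ->
  (forall r, O r -> X r = X' r) -> (forall r, O r -> Y r = Y' r) ->
  cov_endo nabla T X Y q = cov_endo nabla T X' Y' q.
Proof.
move=> Uq sT sX sX' sY sY' XX YY; rewrite /cov_endo.
have st Z : smooth_vf CM O Z -> smooth_vf CM O (tapply T Z).
  exact: (sT _ _ oU (@subset_refl _ O)).
have tt r : O r -> tapply T Y r = tapply T Y' r by move=> Ur; rewrite /tapply (YY r Ur).
by rewrite (nabla_ext hn Uq sX sX' sY sY' XX YY)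
  (nabla_ext hn Uq sX sX' (st _ sY) (st _ sY') XX tt).
Qed.

Lemma torsion_endo_ext (T : M -> 'M[R]_(N + N)) X Y Y' q : O q -> smooth_endo CM O T ->
  smooth_vf CM O X -> smooth_vf CM O Y -> smooth_vf CM O Y' ->
  (forall r, O r -> Y r = Y' r) ->
  torsion_endo nabla T X Y q = torsion_endo nabla T X Y' q.
Proof.
move=> Uq sT sX sY sY' YY; rewrite /torsion_endo.
have st Z : smooth_vf CM O Z -> smooth_vf CM O (tapply T Z).
  exact: (sT _ _ oU (@subset_refl _ O)).
have tt r : O r -> tapply T Y r = tapply T Y' r by move=> Ur; rewrite /tapply (YY r Ur).
have rf Z r : O r -> Z r = Z r :> 'cV[R]_(N + N) by [].
rewrite (cov_endo_ext Uq sT (st _ sX) (st _ sX) sY sY' (rf _) YY).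
rewrite (cov_endo_ext Uq sT (st _ sY) (st _ sY') sX sX tt (rf _)).
rewrite (cov_endo_ext Uq sT sX sX sY sY' (rf _) YY).
by rewrite (cov_endo_ext Uq sT sY sY' sX sX YY (rf _)).
Qed.

Lemma sigma_ext X X' q : O q -> smooth_vf CM O X -> smooth_vf CM O X' ->
  (forall r, O r -> X r = X' r) -> sigma g nabla L X q = sigma g nabla L X' q.
Proof.
move=> Uq sX sX' XX; rewrite /sigma; have sU' := smooth_vf_restrict OU (lac_smooth_U hL).
by rewrite (nabla_ext hn Uq sX sX' sU' sU' XX (fun _ _ => erefl)).
Qed.

(** Normality is stated for the field sU, which is arbitrary outside its
    neighbourhood; this compares it with the extension by zero of its
    restriction. *)
Lemma normal_tensors_ext X Y Y' q : O q ->
  smooth_vf CM O X -> smooth_vf CM O Y -> smooth_vf CM O Y' ->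
  (forall r, O r -> Y r = Y' r) ->
  tensorS g nabla L X Y q = tensorS g nabla L X Y' q /\
  tensorT g nabla L X Y q = tensorT g nabla L X Y' q.
Proof.
move=> Uq sX sY sY' YY.
have tt (T : M -> 'M[R]_(N + N)) r : O r -> tapply T Y r = tapply T Y' r.
  by move=> Ur; rewrite /tapply (YY r Ur).
have st (T : M -> 'M[R]_(N + N)) Z : smooth_endo CM O T -> smooth_vf CM O Z ->
    smooth_vf CM O (tapply T Z).
  by move=> sT; exact: (sT _ _ oU (@subset_refl _ O)).
split; rewrite /tensorS /tensorT (YY q Uq) (sigma_ext Uq sY sY' YY).
  rewrite (torsion_endo_ext Uq sGL sX sY sY' YY).
  by rewrite (sigma_ext Uq (st _ _ sGL sY) (st _ _ sGL sY') (tt _)).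
rewrite (torsion_endo_ext Uq sHL sX sY sY' YY).
by rewrite (sigma_ext Uq (st _ _ sHL sY) (st _ _ sHL sY') (tt _)).
Qed.

Lemma contact_pair_sections : contact_pair gA nA xiA etaA GA HA.
Proof.
have sq (T : V -> V) (t : M -> 'M[R]_(N + N)) :
    (forall X q, O q -> fld (T X) q = t q *m fld X q) ->
    (forall q, O q -> t q *m t q = - 1%:M + sU L q *m su L q + sV L q *m sv L q) ->
    forall X, T (T X) = - X + gA X xiA *: xiA + gA X etaA *: etaA.
  move=> TE tt X; apply: fldP => q Uq.
  apply: (etrans _ (esym (fld_square_value X (metric_xi X Uq) (metric_eta X Uq)
    (xiAE Uq) (etaAE Uq)))).
  apply: (etrans (TE (T X) q Uq)); apply: (etrans (congr1 (mulmx (t q)) (TE X q Uq))).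
  by apply: (etrans (squarep _ Uq (tt q Uq))); rewrite (uE _ Uq) (vE _ Uq).
have sk (T : V -> V) (t : M -> 'M[R]_(N + N)) :
    (forall X q, O q -> fld (T X) q = t q *m fld X q) ->
    (forall q x y, O q -> bil (g q) x (t q *m y) = - bil (g q) (t q *m x) y) ->
    forall X Y, gA X (T Y) = - gA (T X) Y.
  move=> TE tt X Y; apply: fnP => q Uq; rewrite fnN.
  by rewrite (metricAE hg X (T Y) Uq) (metricAE hg (T X) Y Uq) !(TE _ q Uq) (tt q _ _ Uq).
have val0 (T : V -> V) (t : M -> 'M[R]_(N + N)) (W : V) (w : M -> 'cV[R]_(N + N)) :
    (forall X q, O q -> fld (T X) q = t q *m fld X q) -> (forall q, O q -> fld W q = w q) ->
    (forall q, O q -> t q *m w q = 0) -> T W = 0.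
  move=> TE We tw; apply: fldP => q Uq; rewrite fld0.
  by apply: (etrans (TE W q Uq)); rewrite (We q Uq) (tw q Uq).
split.
- exact: endoAD.
- exact: endoAZ.
- exact: endoAD.
- exact: endoAZ.
- apply: fnP => q Uq; rewrite (fn1 CM Uq); apply: (etrans (metric_xi _ Uq)).
  by rewrite (xiAE Uq) (lac_uU hL (OU Uq)).
- apply: fnP => q Uq; rewrite (fn1 CM Uq); apply: (etrans (metric_eta _ Uq)).
  by rewrite (etaAE Uq) (lac_vV hL (OU Uq)).
- apply: fnP => q Uq; rewrite fn0; apply: (etrans (metric_eta _ Uq)).
  by rewrite (xiAE Uq) (lac_vU hL (OU Uq)).
- exact: (val0 _ _ _ _ GAE xiAE (fun q Uq => lac_GU hL (OU Uq))).
- exact: (val0 _ _ _ _ GAE etaAE GVp).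
- exact: (val0 _ _ _ _ HAE xiAE HUp).
- exact: (val0 _ _ _ _ HAE etaAE HVp).
- exact: (sq _ _ GAE (fun q Uq => lac_GG hL (OU Uq))).
- exact: (sq _ _ HAE (fun q Uq => lac_HH hL (OU Uq))).
- move=> X; apply: fldP => q Uq; apply: (etrans _ (esym (fldN_value (GHAE X Uq)))).
  apply: (etrans (HAE (GA X) Uq)); rewrite (GAE X Uq) (mulmxA (sH L q)) (HGp Uq).
  by rewrite mulNmx -mulmxA.
- exact: (sk _ _ GAE (fun q x y Uq => lac_G_skew hL x y (OU Uq))).
- exact: (sk _ _ HAE H_skewp).
- move=> X Y; apply: fnP => q Uq.
  apply: (fn_du_value (nab_metric X Y xiA Uq) (nab_metric Y X xiA Uq)
    (metric_GA X Y Uq) (connformAE X Uq) (metric_eta Y Uq) (connformAE Y Uq) (metric_eta X Uq)).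
  + apply: (@ext_d_dual (su L) xiA X Y q Uq) => r x Ur.
    by rewrite (xiAE Ur) (uE x Ur).
  + exact: (ccm_du hm oU OU Uq (fld_smooth X) (fld_smooth Y)).
  + by [].
- move=> X Y; apply: fnP => q Uq.
  apply: (fn_dv_value (nab_metric X Y etaA Uq) (nab_metric Y X etaA Uq)
    (metric_HA X Y Uq) (connformAE X Uq) (metric_xi Y Uq) (connformAE Y Uq) (metric_xi X Uq)).
  + apply: (@ext_d_dual (sv L) etaA X Y q Uq) => r x Ur.
    by rewrite (etaAE Ur) (vE x Ur).
  + exact: (ccm_dv hm oU OU Uq (fld_smooth X) (fld_smooth Y)).
  + by [].
- move=> X Y /horizontalAP hX /horizontalAP hY; apply: fldP => q Uq; rewrite fld0.
  apply: (etrans (normalS_eval X Y Uq)).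
  by have [] := normal_horizontal hN oU OU Uq (fld_smooth X) (fld_smooth Y) hX hY.
- move=> X Y /horizontalAP hX /horizontalAP hY; apply: fldP => q Uq; rewrite fld0.
  apply: (etrans (normalT_eval X Y Uq)).
  by have [] := normal_horizontal hN oU OU Uq (fld_smooth X) (fld_smooth Y) hX hY.
- move=> X; apply: fldP => q Uq; rewrite fld0; apply: (etrans (normalS_eval X xiA Uq)).
  have sU' := smooth_vf_restrict OU (lac_smooth_U hL).
  have [-> _] := normal_tensors_ext Uq (fld_smooth X) (fld_smooth xiA) sU' xiAE.
  by have [] := normal_vertical hN oU OU Uq (fld_smooth X).
- move=> X; apply: fldP => q Uq; rewrite fld0; apply: (etrans (normalT_eval X etaA Uq)).
  have sV' := smooth_vf_restrict OU (lac_smooth_V hL).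
  have [_ ->] := normal_tensors_ext Uq (fld_smooth X) (fld_smooth etaA) sV' etaAE.
  by have [] := normal_vertical hN oU OU Uq (fld_smooth X).
Qed.

End ContactPairOfStructure.

(** * The invariance theorem *)

Section FrameSums.
Context {R : realType} {N : nat} {M : topologicalType}.
Variable CM : complex_manifold R N M.
Variable U : open_set M.

Lemma fld_sum (I : finType) (F : I -> svf CM U) q :
  fld (\sum_i F i) q = \sum_i fld (F i) q.
Proof.
apply: (big_morph (fun X => fld X q)) => [X Y|]; first by rewrite fldD.
exact: fld0.
Qed.

Lemma fn_sum (I : finType) (F : I -> sfun CM U) q :
  fn (\sum_i F i) q = \sum_i fn (F i) q.
Proof.
apply: (big_morph (fun X => fn X q)) => [X Y|]; first by rewrite fnD.
exact: fn0.
Qed.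
End FrameSums.

Theorem theorem7 (R : realType) (n : nat) (M : topologicalType)
  (CM : complex_manifold R n.*2.+1 M)
  (g : M -> 'M[R]_(n.*2.+1 + n.*2.+1))
  (nabla : (M -> 'cV[R]_(n.*2.+1 + n.*2.+1)) ->
           (M -> 'cV[R]_(n.*2.+1 + n.*2.+1)) ->
           (M -> 'cV[R]_(n.*2.+1 + n.*2.+1)))
  (K : @contact_structure R n.*2.+1 M)
  (S : @almost_contact_structure R n.*2.+1 M)
  (rho : M -> 'M[R]_(n.*2.+1 + n.*2.+1))
  (h_nabla : levi_civita CM g nabla)
  (h_metric : complex_contact_metric CM g nabla K S)
  (h_normal : normal_structure CM g nabla K S)
  (h_rho : is_ricci CM g nabla rho) :
  forall (i : ac_index S) (O : set M) (X Y : M -> 'cV[R]_(n.*2.+1 + n.*2.+1)),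
    open O -> O `<=` ac_nbhd i ->
    smooth_vf CM O X -> smooth_vf CM O Y ->
    horizontal K O X -> horizontal K O Y ->
    forall p, O p ->
      let G := sG (ac_tensors i) p in
      let H := sH (ac_tensors i) p in
      [/\ bil (rho p) (G *m X p) (G *m Y p) = bil (rho p) (X p) (Y p),
          bil (rho p) (H *m X p) (H *m Y p) = bil (rho p) (X p) (Y p),
          bil (rho p) (G *m X p) (Y p) = - bil (rho p) (X p) (G *m Y p) &
          bil (rho p) (H *m X p) (Y p) = - bil (rho p) (X p) (H *m Y p)].
Proof.
move=> i O X Y oO OO sX sY hX hY p Op G H.
pose hac := ccm_almost_contact h_metric.
pose hg : riemannian_metric CM g := hermitian_riemannian (cac_hermitian hac).
pose c := chart_at CM p.
have Ac : atlas CM c := atlas_chart_at CM p.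
have oB : open (O `&` dom c) by apply: openI => //; exact: dom_open Ac.
have [B [E [oBB Bp BO [sE oE]]]] := frame_exists hg oB (conj Op (dom_chart_at CM p)).
pose U := OpenSet oBB.
have Up : carrier U p := Bp.
have UO : carrier U `<=` O by move=> q /BO[].
have Uc : carrier U `<=` dom c by move=> q /BO[].
have OU : carrier U `<=` ac_nbhd i by move=> q /UO /OO.
have LCA := levi_civita_sections hg h_nabla (xiA_unit h_metric OU) Ac Uc.
have C := contact_pair_sections h_nabla h_metric h_normal OU Ac Uc.
have C' := contact_pair_rot LCA C.
pose gA := metricA (CM := CM) (U := U) hg.
pose nA := nablaA (CM := CM) (U := U) h_nabla.
pose EA a : svf CM U := @mkfld _ _ _ CM U _ (sE a).
have EAE a q : carrier U q -> fld (EA a) q = E a q by move=> Uq; exact: fld_mk.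
have frameE Z : Z = \sum_a gA Z (EA a) *: EA a.
  apply: fldP => q Uq; rewrite fld_sum.
  have oEq a b : bil (g q) (fld (EA a) q) (fld (EA b) q) = (a == b)%:R.
    by rewrite (EAE a q Uq) (EAE b q Uq); exact: oE.
  rewrite [LHS](orthonormal_expand _ (metric_sym hg q) oEq); apply: eq_bigr => a _.
  by rewrite fldZ (metricAE hg Z (EA a) Uq).
have rhoE (Z1 Z2 : svf CM U) : bil (rho p) (fld Z1 p) (fld Z2 p) =
    fn (ricci (g := gA) (nab := nA) (E := EA) Z1 Z2) p.
  have frm : orthonormal_frame CM g (carrier U) (fun a => fld (EA a)).
    split=> [a|q a b Uq]; first exact: fld_smooth.
    by rewrite (EAE a q Uq) (EAE b q Uq); exact: oE.
  rewrite (h_rho _ _ _ _ oBB frm (fld_smooth Z1) (fld_smooth Z2) p Bp) fn_sum.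
  apply: eq_bigr => a _.
  by rewrite (metricAE hg _ (EA a) Up) (curvAE h_nabla _ _ _ Up).
(* The fields of the theorem, restricted to a neighbourhood of p that carries a frame. *)
pose XA : svf CM U := @mkfld _ _ _ CM U _ (smooth_vf_restrict UO sX).
pose YA : svf CM U := @mkfld _ _ _ CM U _ (smooth_vf_restrict UO sY).
have XAE : fld XA p = X p by exact: (fld_mk _ Up).
have YAE : fld YA p = Y p by exact: (fld_mk _ Up).
pose hor := is_horizontal gA (xiA h_metric OU) (etaA h_metric OU).
have hXA : hor XA.
  apply/(horizontalAP h_metric OU XA) => j q Uq jq.
  by rewrite (fld_mk _ Uq); exact: (hX j q (UO _ Uq) jq).
have hYA : hor YA.
  apply/(horizontalAP h_metric OU YA) => j q Uq jq.
  by rewrite (fld_mk _ Uq); exact: (hY j q (UO _ Uq) jq).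
(* The second identity is the first one for Y replaced by T Y, as T (T Y) = - Y. *)
have invariant (T : svf CM U -> svf CM U) (t : M -> 'M[R]_(n.*2.+1 + n.*2.+1)) :
    (forall Z q, carrier U q -> fld (T Z) q = t q *m fld Z q) ->
    (forall Z, hor (T Z)) -> (forall Z, hor Z -> T (T Z) = - Z) ->
    (forall Z1 Z2, hor Z1 -> hor Z2 ->
      ricci (g := gA) (nab := nA) (E := EA) (T Z1) (T Z2) =
      ricci (g := gA) (nab := nA) (E := EA) Z1 Z2) ->
    bil (rho p) (t p *m X p) (t p *m Y p) = bil (rho p) (X p) (Y p) /\
    bil (rho p) (t p *m X p) (Y p) = - bil (rho p) (X p) (t p *m Y p).
  move=> TE hT TT ricT.
  have inv Z1 Z2 : hor Z1 -> hor Z2 ->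
      bil (rho p) (fld (T Z1) p) (fld (T Z2) p) = bil (rho p) (fld Z1 p) (fld Z2 p).
    move=> h1 h2; apply: (etrans (rhoE _ _)); apply: (etrans _ (esym (rhoE _ _))).
    by rewrite (ricT _ _ h1 h2).
  rewrite -XAE -YAE -(TE XA p Up) -(TE YA p Up); split; first exact: inv.
  by rewrite -(inv _ _ hXA (hT YA)) (TT _ hYA) fldN bilNr opprK.
have [GG1 GG2] : bil (rho p) (G *m X p) (G *m Y p) = bil (rho p) (X p) (Y p) /\
    bil (rho p) (G *m X p) (Y p) = - bil (rho p) (X p) (G *m Y p).
  apply: (invariant (GA h_metric OU) (sG (ac_tensors i)) (GAE h_metric OU)).
  - exact: (G_hor LCA C).
  - exact: (GG_hor C).
  - exact: (ricci_GG LCA frameE C).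
have [HH1 HH2] : bil (rho p) (H *m X p) (H *m Y p) = bil (rho p) (X p) (Y p) /\
    bil (rho p) (H *m X p) (Y p) = - bil (rho p) (X p) (H *m Y p).
  apply: (invariant (HA h_metric OU) (sH (ac_tensors i)) (HAE h_metric OU)).
  - exact: (H_hor LCA C).
  - exact: (HH_hor C).
  - move=> Z1 Z2 h1 h2; exact: (ricci_GG LCA frameE C' (hor_rot LCA h1) (hor_rot LCA h2)).
by split.
Qed.
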